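(* Let $k$ be a field of characteristic zero, let $d$ be an integer, and let $A$ be a $k$-algebra with $A\in \mathrm{VdB}(d)$ with dualizing bimodule $U$. Let $A\to B$ be a morphism of $k$-algebras such that 1. the functors $B\otimes_A-$ and $-\otimes_A B$ are exact; 2. the canonical map $B\otimes_A B\to B$ induced by multiplication is an isomorphism; and 3. $B\otimes_A U\cong U\otimes_A B$ as $A^e$-modules. Then $B\in \mathrm{VdB}(d)$ with dualizing bimodule $B\otimes_A U\cong B\otimes_A U\otimes_A B$.
   Context: Algebras are associative unital $k$-algebras; all bimodules are $k$-symmetric. For an algebra $A$, $A^e=A\otimes_k A^{\mathrm{op}}$, so that $A$-bimodules are the same as left $A^e$-modules. $H^{\bullet}(A,M)=\mathrm{Ext}^{\bullet}_{A^e}(A,M)$ and $H_{\bullet}(A,M)=\mathrm{Tor}_{\bullet}^{A^e}(A,M)$. An $A$-bimodule $P$ is invertible if there is an $A$-bimodule $Q$ with $P\otimes_A Q\cong A\cong Q\otimes_A P$ as bimodules. ''$A\in\mathrm{VdB}(d)$ with dualizing bimodule $U$'' means: $A$ admits a resolution by finitely generated projective $A^e$-modules, the projective dimension of $A$ as an $A^e$-module is finite, $\mathrm{Ext}^n_{A^e}(A,A^e)=0$ for all $n\ge 0$ with $n\neq d$, and $\mathrm{Ext}^d_{A^e}(A,A^e)\cong U$ as $A$-bimodules, where $U$ is invertible. (By a theorem of Van den Bergh, for algebras admitting a resolution by finitely generated projective $A^e$-modules, this is equivalent to: $U$ is an invertible $A$-bimodule with $H^{\bullet}(A,M)\cong H_{d-\bullet}(A,U\otimes_A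 M)$ for all $A^e$-modules $M$.) Under hypotheses 2 and 3 one has $B\otimes_A U\cong B\otimes_A U\otimes_A B$ as $B\otimes A^{\mathrm{op}}$-modules, and $B\otimes_A U$ is regarded as a $B$-bimodule through this isomorphism. *)

(* Defs.v *)
From HB Require Import structures.
From mathcomp Require Import all_boot all_order all_algebra.
From mathcomp Require Import finmap ring_quotient.
From mathcomp Require Import boolp classical_sets functions cardinality fsbigop.

Set Implicit Arguments.
Unset Strict Implicit.
Unset Printing Implicit Defensive.

Import GRing.Theory.
Local Open Scope ring_scope.
Local Open Scope quotient_scope.

Section FreeModule.
Variables (R : pzRingType) (X : choiceType).

Definition fin_supp : {pred (X -> R^o)} :=
  fun f => `[< finite_set [set x | f x != 0]%classic >].

Lemma fin_supp_closed : submod_closed fin_supp.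
Proof.
split.
  apply/asboolP; apply: (@sub_finite_set _ _ set0) => // x /=.
  by rewrite eqxx.
move=> a f g /asboolP ff /asboolP fg; apply/asboolP.
apply: (@sub_finite_set _ _ ([set x | f x != 0] `|` [set x | g x != 0])%classic).
  move=> x /= h; case: (eqVneq (f x) 0) => [f0|]; last by left.
  right; apply: contra_neq h => g0.
  have -> : (a *: f + g) x = a *: f x + g x by [].
  by rewrite f0 g0 scaler0 addr0.
by rewrite finite_setU.
Qed.

HB.instance Definition _ :=
  GRing.isSubmodClosed.Build R (X -> R^o) fin_supp fin_supp_closed.

Record freemod := FreeMod { freemod_fun :> X -> R^o; _ : fin_supp freemod_fun }.

HB.instance Definition _ := [isSub for freemod_fun].
HB.instance Definition _ := [Choice of freemod by <:].
HB.instance Definition _ := [SubChoice_isSubLmodule of freemod by <:].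

Lemma fdelta_subproof (x : X) : fin_supp (fun y => (y == x)%:R).
Proof.
apply/asboolP; apply: (@sub_finite_set _ _ [set x]%classic) => // y /=.
by case: (y =P x) => //; rewrite eqxx.
Qed.

Definition fdelta (x : X) : freemod := FreeMod (fdelta_subproof x).

Definition fext (V : lmodType R) (g : X -> V) (f : freemod) : V :=
  \sum_(x \in [set: X]) ((f x : R) *: g x).

Definition fsupp (f : freemod) : seq X :=
  enum_fset (fset_set [set x | f x != 0]%classic).

Lemma fsupp_uniq (f : freemod) : uniq (fsupp f).
Proof. exact: fset_uniq. Qed.

Lemma mem_fsupp (f : freemod) (x : X) : (x \in fsupp f) = (f x != 0).
Proof.
case: f => f fP; rewrite /fsupp /= in_fset_set ?mem_setE //.
exact/asboolP.
Qed.

Lemma fextE (V : lmodType R) (g : X -> V) (f : freemod) (r : seq X) :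
  uniq r -> {subset fsupp f <= r} ->
  fext g f = \sum_(x <- r) (f x : R) *: g x.
Proof.
move=> ur sr; rewrite /fext (fsbigE r) //.
  by apply: eq_bigl => x; rewrite in_setT.
move=> x _ xr; have := contra (sr x) xr; rewrite mem_fsupp negbK => /eqP ->.
by rewrite scale0r.
Qed.

Lemma fext_linear (V : lmodType R) (g : X -> V) : linear (fext g).
Proof.
move=> a u v; pose r := undup (fsupp u ++ fsupp v).
have ur : uniq r by exact: undup_uniq.
have su : {subset fsupp u <= r} by move=> x xu; rewrite mem_undup mem_cat xu.
have sv : {subset fsupp v <= r}.
  by move=> x xv; rewrite mem_undup mem_cat xv orbT.
have suv : {subset fsupp (a *: u + v) <= r}.
  move=> x; rewrite mem_undup mem_cat !mem_fsupp -negb_and; apply: contra.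
  case/andP => /eqP u0 /eqP v0.
  have -> : (a *: u + v) x = a *: u x + v x by [].
  by rewrite u0 v0 scaler0 addr0.
rewrite (fextE g ur su) (fextE g ur sv) (fextE g ur suv) scaler_sumr -big_split.
by apply: eq_bigr => x _; rewrite /= scalerA -scalerDl.
Qed.

HB.instance Definition _ (V : lmodType R) (g : X -> V) :=
  GRing.isLinear.Build R freemod V *:%R (fext g) (@fext_linear V g).

Lemma fext_delta (V : lmodType R) (g : X -> V) (x : X) : fext g (fdelta x) = g x.
Proof.
rewrite (@fextE _ _ _ [:: x]) //; last first.
  by move=> y; rewrite mem_fsupp inE /=; case: (y =P x) => //; rewrite eqxx.
by rewrite big_seq1 /= eqxx scale1r.
Qed.

Lemma freemod_expand (f : freemod) : f = fext fdelta f.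
Proof.
rewrite (fextE _ (fsupp_uniq f) (fun _ => id)); apply/val_inj/funext => y.
rewrite raddf_sum /= fct_sumE.
rewrite (eq_bigr (fun x => (f x : R) * (y == x)%:R)) //.
have [yf|] := boolP (y \in fsupp f).
  rewrite (bigD1_seq y) ?fsupp_uniq //= big1 => [|x xy].
    by rewrite eqxx addr0 mulr1.
  by rewrite eq_sym (negbTE xy) mulr0.
move=> yf; rewrite big_seq big1 => [|x xf].
  by move: yf; rewrite mem_fsupp negbK => /eqP.
rewrite (_ : (y == x) = false) ?mulr0 //.
by apply: contraNF yf => /eqP ->.
Qed.
End FreeModule.

Arguments freemod R X : clear implicits.

(* [ra] plays the role of a right action of [R] on [M] and [la] that of a left *)
(* action on [N]: [tensor ra la] is M (x)_R N.                                *)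
Section Tensor.
Variables (R : Type) (M N : zmodType) (ra : M -> R -> M) (la : R -> N -> N).
Notation F := (freemod int (M * N)%type).
Notation delta m n := (fdelta int (m, n)).

Inductive tens_null : F -> Prop :=
| tens_null_addl m m' n : tens_null (delta (m + m') n - delta m n - delta m' n)
| tens_null_addr m n n' : tens_null (delta m (n + n') - delta m n - delta m n')
| tens_null_bal m r n : tens_null (delta (ra m r) n - delta m (la r n))
| tens_null0 : tens_null 0
| tens_nullB x y : tens_null x -> tens_null y -> tens_null (x - y).

Definition tens_rel : {pred F} := fun x => `[< tens_null x >].

Lemma tens_rel_closed : zmod_closed tens_rel.
Proof.
split; first exact/asboolP/tens_null0.
by move=> x y /asboolP xP /asboolP yP; apply/asboolP/tens_nullB.
Qed.

HB.instance Definition _ := GRing.isZmodClosed.Build F tens_rel tens_rel_closed.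

Definition tensor : Type := @Quotient.quot F tens_rel.
HB.instance Definition _ := GRing.Zmodule.on tensor.

Definition tpi (x : F) : tensor := \pi_(@Quotient.quot F tens_rel) x.

Lemma tpiB : {morph tpi : x y / x - y}.
Proof. by move=> x y; rewrite /tpi; rewrite !piE. Qed.

Lemma tpi0 : tpi 0 = 0.
Proof. by rewrite -(subrr 0) tpiB subrr. Qed.

Lemma tpiD : {morph tpi : x y / x + y}.
Proof. by move=> x y; rewrite -{1}[y]opprK -(sub0r y) !tpiB tpi0 sub0r opprK. Qed.

Lemma tpi_eq0 x : tens_null x -> tpi x = 0.
Proof.
move=> xP; rewrite -tpi0; apply/eqP; rewrite -Quotient.idealrBE subr0.
exact/asboolP.
Qed.

Lemma tpi_null x y : tpi x = tpi y -> tens_null (x - y).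
Proof. by move=> /eqP; rewrite -Quotient.idealrBE => /asboolP. Qed.

Definition pure (m : M) (n : N) : tensor := tpi (delta m n).

Lemma pureDl m m' n : pure (m + m') n = pure m n + pure m' n.
Proof.
apply/eqP; rewrite -subr_eq0 opprD addrA -!tpiB.
exact/eqP/tpi_eq0/tens_null_addl.
Qed.

Lemma pureDr m n n' : pure m (n + n') = pure m n + pure m n'.
Proof.
apply/eqP; rewrite -subr_eq0 opprD addrA -!tpiB.
exact/eqP/tpi_eq0/tens_null_addr.
Qed.

Lemma pure_bal m r n : pure (ra m r) n = pure m (la r n).
Proof. by apply/eqP; rewrite -subr_eq0 -tpiB; exact/eqP/tpi_eq0/tens_null_bal. Qed.

Lemma pure0n n : pure 0 n = 0.
Proof. by apply: (addIr (pure 0 n)); rewrite -pureDl !add0r. Qed.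

Lemma puren0 m : pure m 0 = 0.
Proof. by apply: (addIr (pure m 0)); rewrite -pureDr !add0r. Qed.

Lemma pureNl m n : pure (- m) n = - pure m n.
Proof. by apply: (addIr (pure m n)); rewrite -pureDl !addNr pure0n. Qed.

Lemma tensorP (t : tensor) :
  exists s : seq (M * N), t = \sum_(p <- s) pure p.1 p.2.
Proof.
pose P x := exists s : seq (M * N), tpi x = \sum_(p <- s) pure p.1 p.2.
have P0 : P 0 by exists [::]; rewrite big_nil tpi0.
have PB x y : P x -> P y -> P (x - y).
  move=> [s xs] [s' ys]; exists (s ++ [seq (- p.1, p.2) | p <- s']).
  rewrite tpiB xs ys big_cat big_map /= -sumrN; congr (_ + _).
  by apply: eq_bigr => p _; rewrite pureNl.
have PN x : P x -> P (- x) by rewrite -sub0r; exact: PB.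
have PD x y : P x -> P y -> P (x + y).
  by move=> Px Py; rewrite -[y]opprK; apply/PB/PN.
have Pn x n : P x -> P (x *+ n).
  by move=> Px; elim: n => [|n Pxn]; rewrite ?mulr0n // mulrS; apply: PD.
have Pall x : P x.
  rewrite [x]freemod_expand (fextE _ (fsupp_uniq x) (fun _ => id)).
  elim/big_ind: _ => // -[m n] _.
  have Pd : P (delta m n) by exists [:: (m, n)]; rewrite big_seq1.
  rewrite -[X in X *: _]intz scaler_int.
  case: (x (m, n) : int) => k; first exact: Pn.
  by rewrite NegzE mulrNz; apply/PN/Pn.
have [s xs] := Pall (repr t); exists s; rewrite -xs.
by rewrite /tpi reprK.
Qed.

Lemma tensor_ind (P : tensor -> Prop) :
  P 0 -> (forall x y, P x -> P y -> P (x + y)) ->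
  (forall m n, P (pure m n)) -> forall t, P t.
Proof.
move=> P0 PD Pp t; have [s ->] := tensorP t.
by elim/big_ind: _ => // -[m n] _; apply: Pp.
Qed.

Definition tlift (V : zmodType) (f : M -> N -> V) (t : tensor) : V :=
  fext (fun p => f p.1 p.2 : zmodule V) (repr t).

Section Lift.
Variables (V : zmodType) (f : M -> N -> V).
Hypothesis fDl : forall m m' n, f (m + m') n = f m n + f m' n.
Hypothesis fDr : forall m n n', f m (n + n') = f m n + f m n'.
Hypothesis f_bal : forall m r n, f (ra m r) n = f m (la r n).
Let g (p : M * N) : zmodule V := f p.1 p.2.

Lemma tlift_null x : tens_null x -> fext g x = 0.
Proof.
elim=> [m m' n|m n n'|m r n||y z _ yP _ zP]; rewrite ?raddf0 ?raddfB //=.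
- by rewrite !fext_delta /g /= fDl addrAC addrK subrr.
- by rewrite !fext_delta /g /= fDr addrAC addrK subrr.
- by rewrite !fext_delta /g /= f_bal subrr.
- by rewrite yP zP subrr.
Qed.

Lemma tlift_tpi x : tlift f (tpi x) = fext g x.
Proof.
apply/eqP; rewrite -subr_eq0 -[_ - _](raddfB (fext g)); apply/eqP/tlift_null.
by apply: tpi_null; rewrite /tpi reprK.
Qed.

Lemma tlift_pure m n : tlift f (pure m n) = f m n.
Proof. by rewrite tlift_tpi fext_delta. Qed.

Lemma tliftD : {morph tlift f : x y / x + y}.
Proof.
move=> x y; rewrite -[x]reprK -[y]reprK -/(tpi _) -/(tpi _) -tpiD !tlift_tpi.
exact: (raddfD (fext g)).
Qed.

End Lift.
End Tensor.

Arguments pure {R M N ra la} m n.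
Arguments tlift {R M N ra la V} f t.

Section TensorMap.
Variables (R : Type) (M N M' N' : zmodType).
Variables (ra : M -> R -> M) (la : R -> N -> N).
Variables (ra' : M' -> R -> M') (la' : R -> N' -> N').

Definition tmap (f : M -> M') (g : N -> N') : tensor ra la -> tensor ra' la' :=
  tlift (fun m n => pure (f m) (g n)).

Variables (f : M -> M') (g : N -> N').
Hypothesis fD : {morph f : x y / x + y}.
Hypothesis gD : {morph g : x y / x + y}.
Hypothesis f_ra : forall m r, f (ra m r) = ra' (f m) r.
Hypothesis g_la : forall r n, g (la r n) = la' r (g n).

Lemma tmap_pure m n : tmap f g (pure m n) = pure (f m) (g n).
Proof.
apply: tlift_pure => *; first by rewrite fD pureDl.
  by rewrite gD pureDr.
by rewrite f_ra g_la pure_bal.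
Qed.

Lemma tmapD : {morph tmap f g : x y / x + y}.
Proof.
apply: tliftD => *; first by rewrite fD pureDl.
  by rewrite gD pureDr.
by rewrite f_ra g_la pure_bal.
Qed.
End TensorMap.

Arguments tmap {R M N M' N' ra la ra' la'} f g t.

Section HomologicalAlgebra.
Variable R : pzRingType.
Implicit Types M N P : lmodType R.

Definition projective P : Prop :=
  forall (M N : lmodType R) (g : {linear M -> N}) (f : {linear P -> N}),
    (forall y, exists x, g x = y) ->
  exists h : {linear P -> M}, forall x, g (h x) = f x.

Definition fin_gen P : Prop :=
  exists n (e : 'I_n -> P),
    forall x : P, exists c : 'I_n -> R, x = \sum_(i < n) c i *: e i.

Record proj_resolution M := ProjResolution {
  res_mod :> nat -> lmodType R;
  res_d : forall n, {linear res_mod n.+1 -> res_mod n};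
  res_aug : {linear res_mod 0 -> M};
  res_proj : forall n, projective (res_mod n);
  res_aug_surj : forall y, exists x, res_aug x = y;
  res_exact0 : forall x, res_aug x = 0 <-> exists y, res_d 0 y = x;
  res_exact : forall n x, res_d n x = 0 <-> exists y, res_d n.+1 y = x
}.

Definition fg_proj_resolvable M : Prop :=
  exists P : proj_resolution M, forall n, fin_gen (P n).

Definition fin_proj_dim M : Prop :=
  exists (P : proj_resolution M) (n : nat),
    forall i, (n < i)%N -> forall x : P i, x = 0.

End HomologicalAlgebra.

Section Kernel.
Variables (R : pzRingType) (Y Z : lmodType R) (g : {linear Y -> Z}).

Definition ker_pred : {pred Y} := fun y => g y == 0.

Lemma ker_closed : submod_closed ker_pred.
Proof.
split; first by rewrite unfold_in raddf0.
by move=> a x y; rewrite !unfold_in linearP => /eqP -> /eqP ->; rewrite scaler0 addr0.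
Qed.

HB.instance Definition _ := GRing.isSubmodClosed.Build R Y ker_pred ker_closed.

Record kermod := KerMod { kermod_val : Y; _ : ker_pred kermod_val }.

HB.instance Definition _ := [isSub for kermod_val].
HB.instance Definition _ := [Choice of kermod by <:].
HB.instance Definition _ := [SubChoice_isSubLmodule of kermod by <:].

End Kernel.

(* ker g / (ker g :&: im f), for X --f--> Y --g--> Z. *)
Section Homology.
Variables (R : pzRingType) (X Y Z : lmodType R).
Variables (f : {linear X -> Y}) (g : {linear Y -> Z}).

Definition bound_pred : {pred kermod g} :=
  fun z => `[< exists x, f x = kermod_val z >].

Lemma bound_closed : submod_closed bound_pred.
Proof.
split; first by apply/asboolP; exists 0; rewrite raddf0.
move=> a u v /asboolP[x xu] /asboolP[y yv]; apply/asboolP.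
by exists (a *: x + y); rewrite linearP xu yv.
Qed.

HB.instance Definition _ :=
  GRing.isSubmodClosed.Build R (kermod g) bound_pred bound_closed.

Definition homology : Type := @Quotient.quot (kermod g) bound_pred.
HB.instance Definition _ := GRing.Zmodule.on homology.

Definition hclass (z : kermod g) : homology :=
  \pi_(@Quotient.quot (kermod g) bound_pred) z.

Lemma hclassD : {morph hclass : x y / x + y}.
Proof. by move=> x y; rewrite /hclass !piE. Qed.

Lemma hclass_eq x y :
  hclass x = hclass y <-> exists z, f z = kermod_val x - kermod_val y.
Proof.
split=> [/eqP|xy].
  by rewrite -Quotient.idealrBE => /asboolP.
by apply/eqP; rewrite -Quotient.idealrBE; apply/asboolP.
Qed.

Lemma hclass_repr x : hclass (repr x) = x.
Proof. exact: reprK. Qed.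

Definition hscale (a : R) (x : homology) : homology := hclass (a *: repr x).

Lemma hscaleE a x : hscale a (hclass x) = hclass (a *: x).
Proof.
apply/hclass_eq; have /hclass_eq[z zE] := hclass_repr (hclass x).
by exists (a *: z); rewrite linearZ /= zE scalerBr.
Qed.

Lemma hscaleA a b x : hscale a (hscale b x) = hscale (a * b) x.
Proof. by rewrite -[x]hclass_repr !hscaleE scalerA. Qed.

Lemma hscale1 : left_id 1 hscale.
Proof. by move=> x; rewrite -[x]hclass_repr !hscaleE scale1r. Qed.

Lemma hscaleDr : right_distributive hscale +%R.
Proof.
move=> a x y; rewrite -[x]hclass_repr -[y]hclass_repr.
by rewrite -hclassD !hscaleE -hclassD scalerDr.
Qed.

Lemma hscaleDl x : {morph hscale^~ x : a b / a + b}.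
Proof. by move=> a b; rewrite -[x]hclass_repr !hscaleE -hclassD scalerDl. Qed.

HB.instance Definition _ := GRing.Zmodule_isLmodule.Build R homology
  hscaleA hscale1 hscaleDr hscaleDl.

End Homology.

(* Hom_R(P, R) with its right R-module structure, i.e., as a module over R^c: *)
(* (r *: f) x = f x * r.                                                      *)
Section Dual.
Variables (R : pzRingType) (P : lmodType R).

Definition dual : Type := {linear P -> R^o}.

Implicit Types f g h : dual.

Definition dual_fun f : P -> R := (f : {linear P -> R^o}).

Lemma dual_ext f g : dual_fun f =1 dual_fun g -> f = g.
Proof.
case: f g => [f [[f1] [f2]]] [g [[g1] [g2]]] /= /funext.
rewrite /dual_fun /= => fg; case: _ / fg in g1 g2 *.
by rewrite (Prop_irrelevance f1 g1) (Prop_irrelevance f2 g2).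
Qed.

HB.instance Definition _ := gen_eqMixin dual.
HB.instance Definition _ := gen_choiceMixin dual.

Definition dual0 : dual := \0.
Definition dual_add f g : dual :=
  (f : {linear P -> R^o}) \+ (g : {linear P -> R^o}).
Definition dual_opp f : dual := \- (f : {linear P -> R^o}).

Lemma dual_addA : associative dual_add.
Proof. by move=> f g h; apply: dual_ext => x; exact: addrA. Qed.

Lemma dual_addC : commutative dual_add.
Proof. by move=> f g; apply: dual_ext => x; exact: addrC. Qed.

Lemma dual_add0 : left_id dual0 dual_add.
Proof. by move=> f; apply: dual_ext => x; exact: add0r. Qed.

Lemma dual_addN : left_inverse dual0 dual_opp dual_add.
Proof. by move=> f; apply: dual_ext => x; exact: addNr. Qed.

HB.instance Definition _ :=
  GRing.isZmodule.Build dual dual_addA dual_addC dual_add0 dual_addN.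

Definition dual_scale_fun (r : R) f (x : P) : R^o := dual_fun f x * r.

Lemma dual_scale_linear r f : linear (dual_scale_fun r f).
Proof.
move=> a x y; rewrite /dual_scale_fun /dual_fun linearP [LHS]mulrDl.
by congr (_ + _); rewrite /GRing.scale /= mulrA.
Qed.

HB.instance Definition _ r f :=
  GRing.isLinear.Build R P R^o *:%R (dual_scale_fun r f) (dual_scale_linear r f).

Definition dual_scale (r : R^c) f : dual := dual_scale_fun r f.

Lemma dual_scaleA r s f : dual_scale r (dual_scale s f) = dual_scale (r * s) f.
Proof. by apply: dual_ext => x; exact: (esym (mulrA (dual_fun f x) (s : R) r)). Qed.

Lemma dual_scale1 : left_id 1 dual_scale.
Proof. by move=> f; apply: dual_ext => x; exact: mulr1. Qed.

Lemma dual_scaleDr : right_distributive dual_scale +%R.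
Proof. by move=> r f g; apply: dual_ext => x; exact: mulrDl. Qed.

Lemma dual_scaleDl f : {morph dual_scale^~ f : r s / r + s}.
Proof. by move=> r s; apply: dual_ext => x; exact: mulrDr. Qed.

HB.instance Definition _ := GRing.Zmodule_isLmodule.Build R^c dual
  dual_scaleA dual_scale1 dual_scaleDr dual_scaleDl.

End Dual.

Section DualMap.
Variables (R : pzRingType) (P Q : lmodType R) (u : {linear P -> Q}).

Definition dual_map (f : dual Q) : dual P := (f : {linear Q -> R^o}) \o u.

Lemma dual_map_linear : linear dual_map.
Proof. by move=> r f g; apply: dual_ext. Qed.

HB.instance Definition _ :=
  GRing.isLinear.Build R^c (dual Q) (dual P) *:%R dual_map dual_map_linear.

End DualMap.

Section Ext.
Variable R : pzRingType.

(* The n-th cohomology of 0 -> P_0^* -> P_1^* -> ... , with P_i^* := Hom(P_i, R). *)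
Definition dual_cohomology (P : nat -> lmodType R)
    (d : forall n, {linear P n.+1 -> P n}) (n : nat) : lmodType R^c :=
  match n with
  | 0 => kermod (dual_map (d 0))
  | m.+1 => homology (dual_map (d m)) (dual_map (d m.+1))
  end.

Record stage :=
  Stage { stage_src : lmodType R; stage_tgt : lmodType R;
          stage_map : {linear stage_src -> stage_tgt} }.

Definition cover_ker (Y Z : lmodType R) (g : {linear Y -> Z}) :
    {linear freemod R (kermod g) -> Y} :=
  fext (@kermod_val R Y Z g).

Definition next_stage (s : stage) : stage := Stage (cover_ker (stage_map s)).

Variable M : lmodType R.

(* The canonical free resolution of M: P_0 is free on the underlying set of M *)
(* and P_(n+1) is free on the underlying set of ker (P_n -> P_(n-1)).         *)
Definition free_stage (n : nat) : stage :=
  iter n next_stage (Stage (fext id : {linear freemod R M -> M})).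

Definition free_res (n : nat) : lmodType R := stage_src (free_stage n).

Definition free_res_d (n : nat) : {linear free_res n.+1 -> free_res n} :=
  stage_map (free_stage n.+1).

(* Ext^n_R(M, R), as a right R-module.                                        *)
Definition Ext (n : nat) : lmodType R^c := dual_cohomology free_res_d n.

End Ext.

Section FreeResolution.
Variable R : pzRingType.

Lemma freemod_projective (X : choiceType) : projective (freemod R X).
Proof.
move=> M N g f gs; have [s sE] := choice (fun x => gs (f (fdelta R x))).
exists (fext s) => x; rewrite [in RHS](freemod_expand x).
rewrite /= (fextE s (fsupp_uniq x) (fun _ => id)).
rewrite (fextE (fdelta R (X := X)) (fsupp_uniq x) (fun _ => id)) !linear_sum.
by apply: eq_bigr => y _; rewrite !linearZ /= sE.
Qed.

Lemma cover_kerP (Y Z : lmodType R) (g : {linear Y -> Z}) y :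
  g y = 0 <-> exists x, cover_ker g x = y.
Proof.
split=> [gy|[x <-]].
  have gy' : ker_pred g y by apply/eqP.
  by exists (fdelta R (KerMod gy')); exact: fext_delta.
rewrite /cover_ker /= (fextE _ (fsupp_uniq x) (fun _ => id)) linear_sum big1 //.
by move=> [z zP] _; rewrite linearZ /= (eqP zP) scaler0.
Qed.

Variable M : lmodType R.

Lemma free_res_projective n : projective (free_res M n).
Proof. by case: n => [|n]; exact: freemod_projective. Qed.

Lemma free_res_aug_surj (y : M) : exists x : free_res M 0, fext id x = y.
Proof. by exists (fdelta R y); exact: fext_delta. Qed.

Lemma free_res_exact0 (x : free_res M 0) :
  fext id x = 0 <-> exists y, free_res_d M 0 y = x.
Proof. exact: cover_kerP. Qed.

Lemma free_res_exact n (x : free_res M n.+1) :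
  free_res_d M n x = 0 <-> exists y, free_res_d M n.+1 y = x.
Proof. exact: cover_kerP. Qed.

Definition free_resolution : proj_resolution M :=
  ProjResolution free_res_projective free_res_aug_surj
    free_res_exact0 free_res_exact.

End FreeResolution.

(* The library's [algType k] excludes the zero algebra, so an algebra is given *)
(* by its structure map.                                                      *)
Record algebra (k : fieldType) := Algebra {
  alg_ring :> pzRingType;
  alg_str : {rmorphism k -> alg_ring};
  alg_central : forall c x, alg_str c * x = x * alg_str c
}.
Arguments alg_str {k a}.

Record alg_hom (k : fieldType) (A B : algebra k) := AlgHom {
  alg_hom_fun :> {rmorphism A -> B};
  alg_hom_str : forall c, alg_hom_fun (alg_str c) = alg_str c
}.

Definition alg_id (k : fieldType) (A : algebra k) : alg_hom A A :=
  @AlgHom k A A idfun (fun _ => erefl).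

Record bimod (k : fieldType) (A B : algebra k) := Bimod {
  bimod_sort :> zmodType;
  lact : A -> bimod_sort -> bimod_sort;
  ract : bimod_sort -> B -> bimod_sort;
  lactDl : forall a a' m, lact (a + a') m = lact a m + lact a' m;
  lactDr : forall a m m', lact a (m + m') = lact a m + lact a m';
  lact1 : forall m, lact 1 m = m;
  lactM : forall a a' m, lact (a * a') m = lact a (lact a' m);
  ractDl : forall m m' b, ract (m + m') b = ract m b + ract m' b;
  ractDr : forall m b b', ract m (b + b') = ract m b + ract m b';
  ract1 : forall m, ract m 1 = m;
  ractM : forall m b b', ract m (b * b') = ract (ract m b) b';
  lractA : forall a m b, lact a (ract m b) = ract (lact a m) b;
  bimod_sym : forall (c : k) m, lact (alg_str c) m = ract m (alg_str c)
}.

Record bimod_iso (k : fieldType) (A B : algebra k) (M N : bimod A B) := BimodIso {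
  iso_fun :> M -> N;
  iso_inv : N -> M;
  iso_D : {morph iso_fun : x y / x + y};
  iso_lact : forall a x, iso_fun (lact a x) = lact a (iso_fun x);
  iso_ract : forall x b, iso_fun (ract x b) = ract (iso_fun x) b;
  iso_funK : cancel iso_fun iso_inv;
  iso_invK : cancel iso_inv iso_fun
}.

Definition isomorphic (k : fieldType) (A B : algebra k) (M N : bimod A B) : Prop :=
  inhabited (bimod_iso M N).

Section BimodConstructions.
Variable k : fieldType.
Implicit Types A B C : algebra k.

Definition reg_bimod A : bimod A A :=
  @Bimod k A A A *%R *%R
    (fun a a' m => mulrDl a a' m) (fun a m m' => mulrDr a m m') (@mul1r A)
    (fun a a' m => esym (mulrA a a' m)) (fun m m' b => mulrDl m m' b)
    (fun m b b' => mulrDr m b b') (@mulr1 A) (fun m b b' => mulrA m b b')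
    (fun a m b => mulrA a m b) (@alg_central k A).

Program Definition zero_bimod A B : bimod A B :=
  @Bimod k A B 'rV[k]_0 (fun _ m => m) (fun m _ => m) _ _ _ _ _ _ _ _ _ _.
Next Obligation. by rewrite [RHS]thinmx0 [LHS]thinmx0. Qed.
Next Obligation. by rewrite [RHS]thinmx0 [LHS]thinmx0. Qed.

Program Definition res_bimod A' A B' B (f : alg_hom A' A) (g : alg_hom B' B)
    (M : bimod A B) : bimod A' B' :=
  @Bimod k A' B' M (fun a m => lact (f a) m) (fun m b => ract m (g b))
    _ _ _ _ _ _ _ _ _ _.
Next Obligation. by rewrite rmorphD lactDl. Qed.
Next Obligation. by rewrite lactDr. Qed.
Next Obligation. by rewrite rmorph1 lact1. Qed.
Next Obligation. by rewrite rmorphM lactM. Qed.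
Next Obligation. by rewrite ractDl. Qed.
Next Obligation. by rewrite rmorphD ractDr. Qed.
Next Obligation. by rewrite rmorph1 ract1. Qed.
Next Obligation. by rewrite rmorphM ractM. Qed.
Next Obligation. by rewrite lractA. Qed.
Next Obligation. by rewrite !alg_hom_str bimod_sym. Qed.

End BimodConstructions.

Section BimodTensor.
Variables (k : fieldType) (A B C : algebra k) (M : bimod A B) (N : bimod B C).

Notation T := (tensor (@ract k A B M) (@lact k B C N)).

Definition tens_lact (a : A) : T -> T := tmap (lact a) id.
Definition tens_ract (t : T) (c : C) : T := tmap id (fun n => ract n c) t.

Lemma tens_lact_pure a m n : tens_lact a (pure m n) = pure (lact a m) n.
Proof.
apply: (tmap_pure (f := lact a) (g := id)) => // *; first exact: lactDr.
exact: lractA.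
Qed.

Lemma tens_lactDr a t t' : tens_lact a (t + t') = tens_lact a t + tens_lact a t'.
Proof.
apply: (tmapD (f := lact a) (g := id)) => // *; first exact: lactDr.
exact: lractA.
Qed.

Lemma tens_ract_pure m n c : tens_ract (pure m n) c = pure m (ract n c).
Proof.
apply: (tmap_pure (f := id) (g := (@ract k B C N)^~ c)) => // *.
  by move=> ? ?; exact: ractDl.
exact/esym/lractA.
Qed.

Lemma tens_ractDl t t' c : tens_ract (t + t') c = tens_ract t c + tens_ract t' c.
Proof.
apply: (tmapD (f := id) (g := (@ract k B C N)^~ c)) => // *.
  by move=> ? ?; exact: ractDl.
exact/esym/lractA.
Qed.

Lemma tens_lact0 a : tens_lact a 0 = 0.
Proof. by apply: (addIr (tens_lact a 0)); rewrite -tens_lactDr !add0r. Qed.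

Lemma tens_ract0 c : tens_ract 0 c = 0.
Proof. by apply: (addIr (tens_ract 0 c)); rewrite -tens_ractDl !add0r. Qed.

Lemma tens_lactDl a a' t : tens_lact (a + a') t = tens_lact a t + tens_lact a' t.
Proof.
elim/tensor_ind: t => [|x y IHx IHy|m n].
- by rewrite !tens_lact0 addr0.
- by rewrite !tens_lactDr IHx IHy addrACA.
- by rewrite !tens_lact_pure lactDl pureDl.
Qed.

Lemma tens_lact1 t : tens_lact 1 t = t.
Proof.
elim/tensor_ind: t => [|x y IHx IHy|m n].
- by rewrite tens_lact0.
- by rewrite tens_lactDr IHx IHy.
- by rewrite tens_lact_pure lact1.
Qed.

Lemma tens_lactM a a' t : tens_lact (a * a') t = tens_lact a (tens_lact a' t).
Proof.
elim/tensor_ind: t => [|x y IHx IHy|m n].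
- by rewrite !tens_lact0.
- by rewrite !tens_lactDr IHx IHy.
- by rewrite !tens_lact_pure lactM.
Qed.

Lemma tens_ractDr t c c' : tens_ract t (c + c') = tens_ract t c + tens_ract t c'.
Proof.
elim/tensor_ind: t => [|x y IHx IHy|m n].
- by rewrite !tens_ract0 addr0.
- by rewrite !tens_ractDl IHx IHy addrACA.
- by rewrite !tens_ract_pure ractDr pureDr.
Qed.

Lemma tens_ract1 t : tens_ract t 1 = t.
Proof.
elim/tensor_ind: t => [|x y IHx IHy|m n].
- by rewrite tens_ract0.
- by rewrite tens_ractDl IHx IHy.
- by rewrite tens_ract_pure ract1.
Qed.

Lemma tens_ractM t c c' : tens_ract t (c * c') = tens_ract (tens_ract t c) c'.
Proof.
elim/tensor_ind: t => [|x y IHx IHy|m n].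
- by rewrite !tens_ract0.
- by rewrite !tens_ractDl IHx IHy.
- by rewrite !tens_ract_pure ractM.
Qed.

Lemma tens_lractA a t c : tens_lact a (tens_ract t c) = tens_ract (tens_lact a t) c.
Proof.
elim/tensor_ind: t => [|x y IHx IHy|m n].
- by rewrite !(tens_ract0, tens_lact0).
- by rewrite !(tens_ractDl, tens_lactDr) IHx IHy.
- by rewrite !(tens_ract_pure, tens_lact_pure).
Qed.

Lemma tens_sym (c : k) t : tens_lact (alg_str c) t = tens_ract t (alg_str c).
Proof.
elim/tensor_ind: t => [|x y IHx IHy|m n].
- by rewrite !(tens_ract0, tens_lact0).
- by rewrite !(tens_ractDl, tens_lactDr) IHx IHy.
- by rewrite tens_ract_pure tens_lact_pure bimod_sym pure_bal bimod_sym.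
Qed.

Definition tens : bimod A C :=
  @Bimod k A C T tens_lact tens_ract tens_lactDl tens_lactDr tens_lact1
    tens_lactM tens_ractDl tens_ractDr tens_ract1 tens_ractM tens_lractA tens_sym.

End BimodTensor.

Section Transport.
Variables (k : fieldType) (A B : algebra k) (f : alg_hom A B).
Variables (M : bimod B A) (N : bimod B B).
Variable (i : bimod_iso M (res_bimod (alg_id B) f N)).

Definition transport_ract (m : M) (b : B) : M := iso_inv i (ract (i m : N) b).

Lemma transport_ractE m b : i (transport_ract m b) = ract (i m : N) b :> N.
Proof. exact: (iso_invK i). Qed.

Let i_inj : injective i := can_inj (iso_funK i).

(* The (B, A)-bimodule M with the right B-action for which i is B-linear.     *)
Program Definition transport_bimod : bimod B B :=
  @Bimod k B B M (@lact k B A M) transport_ract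
    (@lactDl k B A M) (@lactDr k B A M) (@lact1 k B A M) (@lactM k B A M)
    _ _ _ _ _ _.
Next Obligation.
by apply: i_inj; rewrite (iso_D i) !transport_ractE (iso_D i) [LHS]ractDl.
Qed.
Next Obligation.
by apply: i_inj; rewrite (iso_D i) !transport_ractE [LHS]ractDr.
Qed.
Next Obligation. by apply: i_inj; rewrite transport_ractE ract1. Qed.
Next Obligation. by apply: i_inj; rewrite !transport_ractE ractM. Qed.
Next Obligation.
by apply: i_inj; rewrite iso_lact !transport_ractE iso_lact /= lractA.
Qed.
Next Obligation.
by apply: i_inj; rewrite iso_lact !transport_ractE /= bimod_sym.
Qed.

End Transport.

(* The enveloping algebra A (x)_k A^op; [pure a b] stands for a (x) b^op.     *)
Section Env.
Variables (k : fieldType) (A : algebra k).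

Definition kract (a : A) (c : k) : A := a * alg_str c.
Definition klact (c : k) (b : A) : A := alg_str c * b.

Definition env : Type := tensor kract klact.
HB.instance Definition _ := GRing.Zmodule.on env.

Definition epure (a b : A) : env := pure a b.

Lemma epure_bal a c b : epure (a * alg_str c) b = epure a (alg_str c * b).
Proof. exact: pure_bal. Qed.

Definition env_one : env := epure 1 1.

Definition env_mull (a b : A) : env -> env :=
  tlift (fun a' b' => epure (a * a') (b' * b)).

Lemma env_mull_pure a b a' b' :
  env_mull a b (epure a' b') = epure (a * a') (b' * b).
Proof.
apply: (tlift_pure (f := fun a' b' => epure (a * a') (b' * b))) => *.
- by rewrite mulrDr /epure pureDl.
- by rewrite mulrDl /epure pureDr.
- by rewrite /kract /klact mulrA epure_bal mulrA.
Qed.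

Lemma env_mullD a b : {morph env_mull a b : x y / x + y}.
Proof.
apply: tliftD => *.
- by rewrite mulrDr /epure pureDl.
- by rewrite mulrDl /epure pureDr.
- by rewrite /kract /klact mulrA epure_bal mulrA.
Qed.

Lemma env_mull0 a b : env_mull a b 0 = 0.
Proof. by apply: (addIr (env_mull a b 0)); rewrite -env_mullD !add0r. Qed.

Definition env_mul (x y : env) : env := tlift (fun a b => env_mull a b y) x.

Lemma env_mul_bil y :
  [/\ forall a a' b, env_mull (a + a') b y = env_mull a b y + env_mull a' b y,
      forall a b b', env_mull a (b + b') y = env_mull a b y + env_mull a b' y &
      forall a c b, env_mull (kract a c) b y = env_mull a (klact c b) y].
Proof.
elim/tensor_ind: y => [|x y [x1 x2 x3] [y1 y2 y3]|a' b'].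
- by split=> *; rewrite !env_mull0 ?addr0.
- split=> *; rewrite !env_mullD.
  + by rewrite x1 y1 addrACA.
  + by rewrite x2 y2 addrACA.
  + by rewrite x3 y3.
rewrite -/(epure a' b'); split=> [a a2 b|a b b2|a c b]; rewrite !env_mull_pure.
- by rewrite mulrDl /epure pureDl.
- by rewrite mulrDr /epure pureDr.
rewrite /kract /klact -(mulrA a) alg_central (mulrA a) epure_bal.
by rewrite (mulrA b') -alg_central -(mulrA _ b').
Qed.

Lemma env_mul_purel a b y : env_mul (epure a b) y = env_mull a b y.
Proof.
by have [h1 h2 h3] := env_mul_bil y; exact: (tlift_pure (f := fun a b => env_mull a b y)).
Qed.

Lemma env_mul_pure a b a' b' :
  env_mul (epure a b) (epure a' b') = epure (a * a') (b' * b).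
Proof. by rewrite env_mul_purel env_mull_pure. Qed.

Lemma env_mulDl : left_distributive env_mul +%R.
Proof. by move=> x x' y; have [h1 h2 h3] := env_mul_bil y; exact: tliftD. Qed.

Lemma env_mul0l y : env_mul 0 y = 0.
Proof. by apply: (addIr (env_mul 0 y)); rewrite -env_mulDl !add0r. Qed.

Lemma env_mulDr : right_distributive env_mul +%R.
Proof.
move=> x y z; elim/tensor_ind: x => [|x x' IH IH'|a b].
- by rewrite !env_mul0l addr0.
- by rewrite !env_mulDl IH IH' addrACA.
- by rewrite -/(epure a b) !env_mul_purel env_mullD.
Qed.

Lemma env_mul0r x : env_mul x 0 = 0.
Proof. by apply: (addIr (env_mul x 0)); rewrite -env_mulDr !add0r. Qed.

Lemma env_mulA : associative env_mul.
Proof.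
move=> x y z; elim/tensor_ind: x => [|x x' IH IH'|a b].
- by rewrite !env_mul0l.
- by rewrite !env_mulDl IH IH'.
elim/tensor_ind: y => [|y y' IH IH'|a' b'].
- by rewrite !(env_mul0r, env_mul0l).
- by rewrite !(env_mulDr, env_mulDl) IH IH'.
elim/tensor_ind: z => [|z z' IH IH'|a'' b''].
- by rewrite !env_mul0r.
- by rewrite !env_mulDr IH IH'.
by rewrite -/(epure a b) -/(epure a' b') -/(epure a'' b'') !env_mul_pure !mulrA.
Qed.

Lemma env_mul1l : left_id env_one env_mul.
Proof.
elim/tensor_ind => [|x x' IH IH'|a b].
- exact: env_mul0r.
- by rewrite env_mulDr IH IH'.
- by rewrite -/(epure a b) env_mul_pure mul1r mulr1.
Qed.

Lemma env_mul1r : right_id env_one env_mul.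
Proof.
elim/tensor_ind => [|x x' IH IH'|a b].
- exact: env_mul0l.
- by rewrite env_mulDl IH IH'.
- by rewrite -/(epure a b) env_mul_pure mul1r mulr1.
Qed.

HB.instance Definition _ := GRing.Zmodule_isPzRing.Build env
  env_mulA env_mul1l env_mul1r env_mulDl env_mulDr.

End Env.

(* An A-bimodule as a left A^e-module: (a (x) b) m = a m b.                   *)
Section EnvMod.
Variables (k : fieldType) (A : algebra k) (M : bimod A A).

Definition env_mod : Type := M.
HB.instance Definition _ := GRing.Zmodule.on env_mod.

Definition env_scale (x : env A) (m : env_mod) : env_mod :=
  tlift (fun a b => lact a (ract (m : M) b)) x.

Lemma env_scale_pure a b m : env_scale (epure a b) m = lact a (ract (m : M) b).
Proof.
apply: (tlift_pure (f := fun a b => lact a (ract (m : M) b))) => *.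
- by rewrite lactDl.
- by rewrite ractDr lactDr.
- by rewrite /kract /klact lactM bimod_sym -ractM alg_central.
Qed.

Lemma env_scaleDl m : {morph env_scale^~ m : x y / x + y}.
Proof.
apply: (tliftD (f := fun a b => lact a (ract (m : M) b))) => *.
- by rewrite lactDl.
- by rewrite ractDr lactDr.
- by rewrite /kract /klact lactM bimod_sym -ractM alg_central.
Qed.

Lemma env_scale0 m : env_scale 0 m = 0.
Proof. by apply: (addIr (env_scale 0 m)); rewrite -env_scaleDl !add0r. Qed.

Lemma env_scaleDr : right_distributive env_scale +%R.
Proof.
move=> x m m'; elim/tensor_ind: x => [|x x' IH IH'|a b].
- by rewrite !env_scale0 addr0.
- by rewrite !env_scaleDl IH IH' addrACA.
- by rewrite -/(epure a b) !env_scale_pure ractDl lactDr.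
Qed.

Lemma env_scaler0 x : env_scale x 0 = 0.
Proof. by apply: (addIr (env_scale x 0)); rewrite -env_scaleDr !add0r. Qed.

Lemma env_scaleA x y m : env_scale x (env_scale y m) = env_scale (x * y) m.
Proof.
elim/tensor_ind: x => [|x x' IH IH'|a b].
- by rewrite mul0r !env_scale0.
- by rewrite mulrDl !env_scaleDl IH IH'.
elim/tensor_ind: y => [|y y' IH IH'|a' b'].
- by rewrite mulr0 env_scale0 env_scaler0.
- by rewrite mulrDr !env_scaleDl env_scaleDr IH IH'.
rewrite -/(epure a b) -/(epure a' b') [_ * _]env_mul_pure !env_scale_pure.
by rewrite -lractA -ractM lactM.
Qed.

Lemma env_scale1 : left_id 1 env_scale.
Proof. by move=> m; rewrite [LHS]env_scale_pure ract1 lact1. Qed.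

HB.instance Definition _ := GRing.Zmodule_isLmodule.Build (env A) env_mod
  env_scaleA env_scale1 env_scaleDr env_scaleDl.

End EnvMod.

(* A right A^e-module as an A-bimodule: a m b = m (b (x) a). Applied to A^e   *)
(* itself, this is its inner structure a (x (x) y) b = x b (x) a y.           *)
Program Definition bimod_of_right (k : fieldType) (A : algebra k)
    (E : lmodType (env A)^c) : bimod A A :=
  @Bimod k A A E (fun a m => (epure 1 a : (env A)^c) *: m)
    (fun m b => (epure b 1 : (env A)^c) *: m) _ _ _ _ _ _ _ _ _ _.
Next Obligation. by rewrite -scalerDl /epure pureDr. Qed.
Next Obligation. exact: scalerDr. Qed.
Next Obligation. exact: scale1r. Qed.
Next Obligation.
by rewrite [RHS]scalerA; congr (_ *: _); rewrite [RHS]env_mul_pure mul1r.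
Qed.
Next Obligation. exact: scalerDr. Qed.
Next Obligation. by rewrite -scalerDl /epure pureDl. Qed.
Next Obligation. exact: scale1r. Qed.
Next Obligation. by rewrite [RHS]scalerA; congr (_ *: _); rewrite [RHS]env_mul_pure mul1r. Qed.
Next Obligation.
by rewrite !scalerA; congr (_ *: _); rewrite [LHS]env_mul_pure [RHS]env_mul_pure
  !mul1r !mulr1.
Qed.
Next Obligation.
congr (_ *: _); have := @epure_bal k A 1 c 1.
by rewrite mul1r mulr1 => ->.
Qed.

Section VanDenBergh.
Variables (k : fieldType) (A : algebra k).

Definition invertible (P : bimod A A) : Prop :=
  exists Q : bimod A A,
    isomorphic (tens P Q) (reg_bimod A) /\ isomorphic (tens Q P) (reg_bimod A).

(* Ext^n_(A^e)(A, A^e), as an A-bimodule.                                     *)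
Definition Ext_env (n : nat) : bimod A A :=
  bimod_of_right (Ext (env_mod (reg_bimod A)) n).

Definition Ext_envz (d : int) : bimod A A :=
  match d with
  | Posz n => Ext_env n
  | Negz _ => zero_bimod A A
  end.

Record VdB (d : int) (U : bimod A A) : Prop := {
  VdB_fg : fg_proj_resolvable (env_mod (reg_bimod A));
  VdB_pd : fin_proj_dim (env_mod (reg_bimod A));
  VdB_vanish : forall n : nat, Posz n <> d -> forall x : Ext_env n, x = 0;
  VdB_dual : isomorphic (Ext_envz d) U;
  VdB_inv : invertible U
}.

End VanDenBergh.

Section BaseChange.
Variables (k : fieldType) (A B : algebra k) (phi : alg_hom A B).

Definition short_exact (L M N : zmodType) (f : L -> M) (g : M -> N) : Prop :=
  [/\ injective f, forall y, g y = 0 <-> exists x, f x = y &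
      forall z, exists y, g y = z].

Definition left_tensor_exact : Prop :=
  forall (L M N : lmodType A) (f : {linear L -> M}) (g : {linear M -> N}),
    short_exact f g ->
  let B_tensor (X : lmodType A) :=
    tensor (fun (b : B) (a : A) => b * phi a) (fun (a : A) (x : X) => a *: x) in
  short_exact (tmap id f : B_tensor L -> B_tensor M)
              (tmap id g : B_tensor M -> B_tensor N).

Definition right_tensor_exact : Prop :=
  forall (L M N : lmodType A^c) (f : {linear L -> M}) (g : {linear M -> N}),
    short_exact f g ->
  let tensor_B (X : lmodType A^c) :=
    tensor (fun (x : X) (a : A) => (a : A^c) *: x) (fun (a : A) (b : B) => phi a * b) in
  short_exact (tmap f id : tensor_B L -> tensor_B M)
              (tmap g id : tensor_B M -> tensor_B N).

Definition bimodBA : bimod B A := res_bimod (alg_id B) phi (reg_bimod B).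
Definition bimodAB : bimod A B := res_bimod phi (alg_id B) (reg_bimod B).
Definition bimodAA : bimod A A := res_bimod phi phi (reg_bimod B).

Definition mult_map : tens bimodBA bimodAB -> B := tlift (fun b b' : B => b * b').

End BaseChange.

(* Main.v *)
Require Import Defs.
From HB Require Import structures.
From mathcomp Require Import all_boot all_order all_algebra.
From mathcomp Require Import boolp.

(** Write F for the functor B (x)_A - (x)_A B from A-bimodules to B-bimodules.
    It is base change along the map A^e -> B^e of enveloping algebras, both for
    left modules and, after exchanging the two sides, for right modules; by the
    first hypothesis it is exact ([left_bc_exact], [right_bc_exact]).

    By the second hypothesis F(A) = B (x)_A B = B ([bichange_reg]). Base change
    preserves projectives and finite generation, so F turns a resolution P of A
    by finitely generated projective A^e-modules into one of B over B^e, and a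
    finite projective resolution into a finite one. For P finitely generated
    projective the natural map F(Hom(P, A^e)) -> Hom(F(P), B^e) is bijective
    ([bc_dual_bij]), by an explicit inverse built from a dual basis. As F is
    exact it commutes with cohomology, whence Ext(B, B^e) = F(Ext(A, A^e)) in
    every degree ([bc_Ext], [Ext_env_bichange]). This gives the vanishing outside
    degree d and the dualizing bimodule F(U) = B U B. Since Ext is defined through
    the canonical free resolution, which is not finitely generated, this needs
    the invariance of Ext under change of resolution ([homology_of_Ext]).

    Invertibility of B U B is formal: U B = B U as A-bimodules and B B = B, so a
    factor B can be moved across U and absorbed ([bichange_invertible]). The same
    computation gives B U B = B U, and being in VdB(d) depends on the dualizing
    bimodule only up to isomorphism. *)

Set Implicit Arguments.
Unset Strict Implicit.
Unset Printing Implicit Defensive.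

Import GRing.Theory.
Local Open Scope ring_scope.

(** * Linear maps, kernels and cokernels *)

Lemma additive0 (U V : zmodType) (f : U -> V) : {morph f : x y / x + y} -> f 0 = 0.
Proof. by move=> fD; apply: (addIr (f 0)); rewrite -fD !add0r. Qed.

Definition mk_linear (R : pzRingType) (M N : lmodType R) (f : M -> N)
    (fD : {morph f : x y / x + y}) (fZ : forall a x, f (a *: x) = a *: f x) :
    {linear M -> N} :=
  let f_linear : linear f :=
    fun a x y => etrans (fD _ _) (congr1 (fun z => z + f y) (fZ a x)) in
  HB.pack_for {linear M -> N} f (GRing.isLinear.Build R M N *:%R f f_linear).

Definition lmod_iso (R : pzRingType) (M N : lmodType R) : Prop :=
  exists f : {linear M -> N}, bijective f.

Lemma lmod_isoI (R : pzRingType) (M N : lmodType R) (f : {linear M -> N}) :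
  (forall x, f x = 0 -> x = 0) -> (forall y, exists x, f x = y) -> lmod_iso M N.
Proof.
move=> f_inj f_surj; have [g gE] := choice f_surj.
exists f, g => // x; apply/eqP; rewrite -subr_eq0; apply/eqP/f_inj.
by rewrite raddfB /= gE subrr.
Qed.

Section KernelFactor.
Variables (R : pzRingType) (X Y Z : lmodType R).
Variables (g : {linear Y -> Z}) (f : {linear X -> Y}).
Hypothesis gf0 : forall x, g (f x) = 0.

Let f_ker x : ker_pred g (f x). Proof. exact/eqP. Qed.

Lemma ker_factor : exists h : {linear X -> kermod g}, forall x, kermod_val (h x) = f x.
Proof.
pose h x := KerMod (f_ker x).
have hD : {morph h : x y / x + y} by move=> x y; apply/val_inj; exact: raddfD.
have hZ a x : h (a *: x) = a *: h x by apply/val_inj; exact: linearZ.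
by exists (mk_linear hD hZ).
Qed.
End KernelFactor.

Definition ker_incl (R : pzRingType) (Y Z : lmodType R) (g : {linear Y -> Z}) :
    {linear kermod g -> Y} :=
  mk_linear (f := @kermod_val _ _ _ g) (fun _ _ => erefl) (fun _ _ => erefl).

Lemma kermodP (R : pzRingType) (Y Z : lmodType R) (g : {linear Y -> Z}) y :
  g y = 0 <-> exists k : kermod g, kermod_val k = y.
Proof.
split=> [gy | [[x /eqP gx] <-] //].
have gy' : ker_pred g y by apply/eqP.
by exists (KerMod gy').
Qed.

Section Cokernel.
Variables (R : pzRingType) (X Y : lmodType R) (f : {linear X -> Y}).

(** The homology of [X -> Y -> 0]; its elements are classes of elements of
    [kermod \0], that is, of [Y]. *)
Definition coker : lmodType R := homology f (\0 : {linear Y -> Y}).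

Lemma coker_projection : exists p : {linear Y -> coker},
  (forall z, exists y, p y = z) /\ (forall y, p y = 0 <-> exists x, f x = y).
Proof.
pose g := \0 : {linear Y -> Y}.
have in_ker y : ker_pred g y by apply/eqP.
pose p (y : Y) : homology f g := hclass f (KerMod (in_ker y)).
have pD : {morph p : x y / x + y}.
  by move=> x y; rewrite /p -hclassD; congr hclass; apply/val_inj.
have pZ a x : p (a *: x) = a *: p x.
  by rewrite [RHS]hscaleE; congr hclass; apply/val_inj.
exists (mk_linear pD pZ); split=> [z|y] /=.
  rewrite -[z]hclass_repr; case: (repr z) => y yP; exists y.
  by congr hclass; apply/val_inj.
have p0 : p 0 = 0 by exact: additive0.
rewrite -[X in _ = X]p0; split=> [/hclass_eq[x] | [x fx]].
  by rewrite /= subr0; exists x.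
by apply/hclass_eq; exists x; rewrite /= subr0.
Qed.
End Cokernel.

(** A projective module lifts along [f] as soon as the map to be lifted takes
    its values in the image of [f]: that image is the kernel of the projection
    to the cokernel, and [X] surjects onto it. *)
Lemma projective_lift (R : pzRingType) (P X Y : lmodType R)
    (f : {linear X -> Y}) (h : {linear P -> Y}) :
  projective P -> (forall p, exists x, f x = h p) ->
  exists l : {linear P -> X}, forall p, f (l p) = h p.
Proof.
move=> P_proj h_im; have [g [_ ex]] := coker_projection f.
have gf0 x : g (f x) = 0 by apply/ex; exists x.
have gh0 p : g (h p) = 0 by exact/ex.
have [f' f'E] := ker_factor gf0; have [h' h'E] := ker_factor gh0.
have f'_surj k : exists x, f' x = k.
  have /ex[x fx] : g (kermod_val k) = 0 by apply/kermodP; exists k.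
  by exists x; apply/val_inj; rewrite /= f'E.
have [l lE] := P_proj _ _ f' h' f'_surj.
by exists l => p; rewrite -f'E lE h'E.
Qed.

(** * Comparison of projective resolutions *)

Section Comparison.
Variables (R : pzRingType) (M : lmodType R).
Implicit Types P Q : proj_resolution M.

(** The differential out of [P n], with the zero map of [P 0] as a convention in
    degree 0. This makes the zeroth cohomology of the dual complex, which has no
    boundaries, the homology of a pair of maps as in every other degree. *)
Definition res_pd P n : {linear P n -> P n.-1} :=
  match n with 0 => \0 | m.+1 => res_d P m end.

Lemma res_dd P n x : res_d P n (res_d P n.+1 x) = 0.
Proof. by apply/(res_exact (p := P)); exists x. Qed.

Lemma res_pdd P n x : res_pd P n (res_d P n x) = 0.
Proof. case: n x => [|n] x //; exact: res_dd. Qed.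

Definition chain_map P Q (f : forall n, {linear P n -> Q n}) : Prop :=
  (forall x, res_aug Q (f 0 x) = res_aug P x) /\
  (forall n x, res_d Q n (f n.+1 x) = f n (res_d P n x)).

(** Projectivity lifts the identity of [M] one degree at a time; exactness of
    [Q] is what keeps the next lifting problem solvable. *)
Lemma chain_map_exists P Q : exists f : forall n, {linear P n -> Q n}, chain_map f.
Proof.
have [f0 f0E] := @res_proj _ _ P 0 _ _ (res_aug Q) (res_aug P) (@res_aug_surj _ _ Q).
(* [good n f] says exactly that [f] can be continued to degree n + 1. *)
pose good n (f : {linear P n -> Q n}) :=
  forall x, exists y, res_d Q n y = f (res_d P n x).
have step n (f : {linear P n -> Q n}) : good n f ->
    exists f' : {linear P n.+1 -> Q n.+1},
      (forall x, res_d Q n (f' x) = f (res_d P n x)) /\ good n.+1 f'.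
  move=> gf; have [f' f'E] :=
    projective_lift (f := res_d Q n) (h := f \o res_d P n) (@res_proj _ _ P n.+1) gf.
  exists f'; split=> // x; apply/(res_exact (p := Q)).
  by rewrite f'E /= res_dd raddf0.
have good0 : good 0 f0.
  move=> x; apply/(res_exact0 (p := Q)); rewrite f0E.
  by apply/(res_exact0 (p := P)); exists x.
pose next n (s : {f | good n f}) : {f | good n.+1 f} :=
  let c := cid (step n (sval s) (svalP s)) in exist _ (sval c) (svalP c).2.
pose fix seqf n : {f | good n f} :=
  match n with 0 => exist _ f0 good0 | m.+1 => next m (seqf m) end.
exists (fun n => sval (seqf n)); split=> [x|n x]; first exact: f0E.
by rewrite /=; case: cid => f' [].
Qed.

Lemma chain_map_pd P Q (f : forall n, {linear P n -> Q n}) n x :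
  chain_map f -> res_pd Q n (f n x) = f n.-1 (res_pd P n x).
Proof. by case: n x => [|n] x [_ fd] /=; rewrite ?raddf0 // fd. Qed.

(** What a partial homotopy leaves over in the next degree is a cycle, hence a
    boundary by exactness, so projectivity continues the homotopy. Only two of
    its consecutive terms matter in a given degree, so they need not be assembled
    into a sequence. *)
Lemma chain_map_homotopy P (f : forall n, {linear P n -> P n}) n :
  chain_map f ->
  exists (h : {linear P n -> P n.+1}) (l : {linear P n.-1 -> P n}),
    forall x, f n x - x = res_d P n (h x) + l (res_pd P n x).
Proof.
move=> [f_aug fd]; elim: n => [|n [h [l hl]]].
  have [h hE] : exists h : {linear P 0 -> P 1},
      forall x, res_d P 0 (h x) = (f 0 \- idfun) x.
    apply: (projective_lift (@res_proj _ _ P 0)) => x.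
    by apply/(res_exact0 (p := P)); rewrite raddfB /= f_aug subrr.
  by exists h, idfun => x; rewrite hE /= addr0.
have [h' h'E] : exists h' : {linear P n.+1 -> P n.+2},
    forall x, res_d P n.+1 (h' x) = ((f n.+1 \- idfun) \- (h \o res_d P n)) x.
  apply: (projective_lift (@res_proj _ _ P n.+1)) => x.
  apply/(res_exact (p := P)).
  by rewrite !raddfB /= fd hl res_pdd raddf0 addr0 subrr.
by exists h', h => x; rewrite h'E /= subrK.
Qed.

End Comparison.
(** * Ext from an arbitrary projective resolution *)

(** [H] is the homology of [X -> Y -> Z], presented by cycles [K] included in
    [Y] and projected onto [H]. Stating this by exactness properties of maps,
    instead of through a chosen subquotient, makes its preservation by exact
    functors immediate. *)
Definition homology_of (R : pzRingType) (X Y Z H : lmodType R)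
    (f : {linear X -> Y}) (g : {linear Y -> Z}) : Prop :=
  exists (K : lmodType R) (i : {linear K -> Y}) (q : {linear K -> H}),
    [/\ injective i, forall y, g y = 0 <-> exists k, i k = y,
        forall h, exists k, q k = h & forall k, q k = 0 <-> exists x, f x = i k].

Lemma homology_of_iso (R : pzRingType) (X Y Z H H' : lmodType R)
    (f : {linear X -> Y}) (g : {linear Y -> Z}) :
  lmod_iso H H' -> homology_of H f g -> homology_of H' f g.
Proof.
case=> w [w' wK w'K] [K [i [q [i_inj i_im q_surj q_ker]]]].
exists K, i, (w \o q); split=> //= [h|k].
  by have [k kh] := q_surj (w' h); exists k; rewrite kh w'K.
rewrite -q_ker; split=> [|-> //]; last by rewrite raddf0.
by move=> wq0; apply: (can_inj wK); rewrite wq0 raddf0.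
Qed.

Lemma homology_of_homology (R : pzRingType) (X Y Z : lmodType R)
    (f : {linear X -> Y}) (g : {linear Y -> Z}) :
  homology_of (homology f g) f g.
Proof.
have cZ a z : hclass f (a *: z : kermod g) = a *: hclass f z.
  by rewrite [RHS]hscaleE.
pose q : {linear kermod g -> homology f g} := mk_linear (@hclassD _ _ _ _ f g) cZ.
exists (kermod g), (ker_incl g), q.
split=> [k k' /val_inj //| y | h | k] /=; first exact: kermodP.
  by exists (repr h); exact: hclass_repr.
rewrite -[X in _ = X](raddf0 q) hclass_eq.
by split=> -[x fx]; exists x; rewrite fx /= subr0.
Qed.

Lemma homology_of_kermod (R : pzRingType) (X Y Z : lmodType R) (g : {linear Y -> Z}) :
  homology_of (kermod g) (\0 : {linear X -> Y}) g.
Proof.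
exists (kermod g), (ker_incl g), idfun.
split=> [k k' /val_inj //| y | h | k] /=; first exact: kermodP.
  by exists h.
by split=> [-> | [x k0]]; [exists 0 | apply/val_inj].
Qed.

Section InducedIso.
Variables (R : pzRingType) (X Y Z H X' Y' Z' H' : lmodType R).
Variables (f : {linear X -> Y}) (g : {linear Y -> Z}).
Variables (f' : {linear X' -> Y'}) (g' : {linear Y' -> Z'}).
Variable u : {linear Y -> Y'}.
Hypothesis u_cycle : forall y, g y = 0 -> g' (u y) = 0.
Hypothesis u_bound : forall x, exists x', f' x' = u (f x).
Hypothesis u_inj : forall y, g y = 0 -> (exists x', f' x' = u y) ->
  exists x, f x = y.
Hypothesis u_surj : forall y', g' y' = 0 ->
  exists y, g y = 0 /\ exists x', f' x' = y' - u y.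

(** The isomorphism is given by lifting a class to a cycle, applying [u] and
    taking the class of the result; [u_bound] makes it independent of the lift.
    Conditions on elements replace a map of complexes, so that [u] alone, in one
    degree, has to be given as a map. *)
Lemma homology_of_map_iso :
  homology_of H f g -> homology_of H' f' g' -> lmod_iso H H'.
Proof.
move=> [K [i [q [i_inj i_im q_surj q_ker]]]].
move=> [K' [i' [q' [i'_inj i'_im q'_surj q'_ker]]]].
have /choice[t tE] k : exists k', i' k' = u (i k).
  by apply/i'_im/u_cycle/i_im; exists k.
have tD : {morph t : x y / x + y}.
  by move=> x y; apply: i'_inj; rewrite raddfD /= !tE !raddfD.
have tZ a x : t (a *: x) = a *: t x.
  by apply: i'_inj; rewrite linearZ /= !tE !linearZ.
pose tl : {linear K -> K'} := mk_linear tD tZ.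
have qt k : q' (t k) = 0 <-> q k = 0.
  rewrite q'_ker q_ker tE; split; first by apply: u_inj; apply/i_im; exists k.
  by move=> [x <-]; exact: u_bound.
have [s sE] := choice q_surj.
have sP k : q' (t (s (q k))) = q' (t k).
  apply/eqP; rewrite -subr_eq0 -[_ - _](raddfB (q' \o tl)) /=.
  by apply/eqP/qt; rewrite raddfB /= sE subrr.
pose w h := q' (t (s h)).
have wD : {morph w : x y / x + y}.
  move=> x y; rewrite /w -[x in LHS]sE -[y in LHS]sE -(raddfD q) sP.
  by rewrite tD raddfD.
have wZ a x : w (a *: x) = a *: w x.
  have qa : q (a *: s x) = a *: x by rewrite linearZ /= sE.
  by rewrite /w -[in LHS]qa sP tZ linearZ.
apply: (lmod_isoI (f := mk_linear wD wZ)) => [h /= /qt | h' /=].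
  by rewrite sE.
have [k' <-] := q'_surj h'.
have /u_surj[y [/i_im[k <-] bound]] : g' (i' k') = 0 by apply/i'_im; exists k'.
exists (q k); rewrite /w sP; apply/esym/eqP; rewrite -subr_eq0 -raddfB.
by apply/eqP/q'_ker; rewrite raddfB /= tE.
Qed.
End InducedIso.

Lemma homology_of_dual_cohomology (R : pzRingType) (M : lmodType R)
    (P : proj_resolution M) n :
  homology_of (dual_cohomology (res_d P) n)
    (dual_map (res_pd P n)) (dual_map (res_d P n)).
Proof.
case: n => [|n]; last exact: homology_of_homology.
have [K [i [q [i_inj i_im q_surj q_ker]]]] :=
  homology_of_kermod (dual (P 0)) (dual_map (res_d P 0)).
exists K, i, q; split=> // k; rewrite q_ker.
have d0 x : dual_map (res_pd P 0) x = 0.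
  by apply: dual_ext => y; exact: raddf0.
by split=> -[x <-]; exists x; [exact: d0 | exact/esym/d0].
Qed.

(** The comparison maps between two resolutions are mutually inverse up to
    homotopy, and composition with a homotopy turns a cocycle into the difference
    of two cohomologous cocycles. *)
Lemma dual_cohomology_iso (R : pzRingType) (M : lmodType R)
    (P Q : proj_resolution M) n :
  lmod_iso (dual_cohomology (res_d P) n) (dual_cohomology (res_d Q) n).
Proof.
have [f f_chain] := chain_map_exists Q P.
have [g g_chain] := chain_map_exists P Q.
have gf_chain : chain_map (fun n => g n \o f n).
  case: f_chain g_chain => [fa fd] [ga gd].
  by split=> [x|m x] /=; rewrite ?ga ?gd ?fd.
have fg_chain : chain_map (fun n => f n \o g n).
  case: f_chain g_chain => [fa fd] [ga gd].
  by split=> [x|m x] /=; rewrite ?fa ?fd ?gd.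
have cocycleE (T : proj_resolution M) (y : dual (T n)) :
    dual_map (res_d T n) y = 0 <-> forall x, dual_fun y (res_d T n x) = 0.
  split=> [y0 x|y0]; last by apply: dual_ext => x; exact: y0.
  exact: (congr1 (fun z => dual_fun z x) y0).
have boundaryE (T : proj_resolution M) (y : dual (T n)) :
    (exists x, dual_map (res_pd T n) x = y) <->
    exists x : dual (T n.-1), forall z, dual_fun x (res_pd T n z) = dual_fun y z.
  split=> -[x xE]; exists x; first by move=> z; rewrite -xE.
  by apply: dual_ext => z; exact: xE.
have cocycle_homotopic (T : proj_resolution M) (e : forall n, {linear T n -> T n})
    (y : dual (T n)) : chain_map e -> dual_map (res_d T n) y = 0 ->
    exists x, dual_map (res_pd T n) x = dual_map (e n) y - y.
  move=> /(chain_map_homotopy n)[h [l hl]] /cocycleE y0.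
  apply/boundaryE; exists (dual_map l y) => z.
  have -> : dual_fun (dual_map (e n) y - y) z = dual_fun y (e n z - z).
    by rewrite /dual_fun raddfB.
  by rewrite hl /dual_fun raddfD /= -!/(dual_fun _ _) y0 add0r.
apply: (homology_of_map_iso (u := dual_map (f n)))
  (homology_of_dual_cohomology P n) (homology_of_dual_cohomology Q n).
- move=> y /cocycleE y0; apply/cocycleE => x.
  by case: f_chain => _ fd; rewrite -(y0 (f n.+1 x)) /dual_fun /= fd.
- move=> x; exists (dual_map (f n.-1) x); apply: dual_ext => z.
  by rewrite /dual_fun /= chain_map_pd.
- move=> y y0 /boundaryE[x' x'E].
  have [x xE] := cocycle_homotopic _ _ y fg_chain y0.
  exists (dual_map (g n.-1) x' - x); rewrite raddfB /= xE opprB addrCA.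
  rewrite [X in _ + X](_ : _ = 0) ?addr0 //; apply/eqP; rewrite subr_eq0; apply/eqP.
  apply: dual_ext => z; rewrite /dual_fun /= -chain_map_pd //; exact: x'E.
- move=> y' y'0.
  have [x xE] := cocycle_homotopic _ _ y' gf_chain y'0.
  exists (dual_map (g n) y'); split.
    apply/cocycleE => z; move/cocycleE: y'0 => y'0.
    by case: g_chain => _ gd; rewrite -(y'0 (g n.+1 z)) /dual_fun /= gd.
  by exists (- x); rewrite raddfN /= xE opprB; congr (_ - _); apply: dual_ext.
Qed.

Lemma homology_of_Ext (R : pzRingType) (M : lmodType R) (P : proj_resolution M) n :
  homology_of (Ext M n) (dual_map (res_pd P n)) (dual_map (res_d P n)).
Proof.
exact: homology_of_iso (dual_cohomology_iso P (free_resolution M) n)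
  (homology_of_dual_cohomology P n).
Qed.
(** * Base change of modules along a ring map *)

(** The functor S (x)_R - along psi : R -> S, known only through its universal
    property: every module comes with a psi-semilinear map to its base change
    which spans it, and semilinear maps extend along it. The concrete models are
    the functors B (x)_A - (x)_A B on left and on right modules over the
    enveloping algebra. The map [psi] is a bare function so that one and the same
    [psi] also serves as a map between the opposite rings. *)
Record base_change (R S : pzRingType) (psi : R -> S) := BaseChange {
  bc_mod :> lmodType R -> lmodType S;
  bc_unit : forall M : lmodType R, M -> bc_mod M;
  bc_unitD : forall M, {morph @bc_unit M : x y / x + y};
  bc_unitZ : forall (M : lmodType R) r (x : M), bc_unit (r *: x) = psi r *: bc_unit x;
  bc_span : forall (M : lmodType R) (y : bc_mod M),
    exists s : seq (S * M), y = \sum_(p <- s) p.1 *: bc_unit p.2;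
  bc_extend : forall (M : lmodType R) (N : lmodType S) (v : M -> N),
    {morph v : x y / x + y} -> (forall r x, v (r *: x) = psi r *: v x) ->
    exists w : {linear bc_mod M -> N}, forall x, w (bc_unit x) = v x
}.
Arguments bc_unit {R S psi} b {M} x.

Section BaseChangeFunctor.
Variables (R S : pzRingType) (psi : R -> S) (F : base_change psi).
Implicit Types L M N : lmodType R.

Lemma bc_ind M (Pr : F M -> Prop) : Pr 0 ->
  (forall x y, Pr x -> Pr y -> Pr (x + y)) ->
  (forall s x, Pr (s *: bc_unit F x)) -> forall y, Pr y.
Proof.
by move=> P0 PD PZ y; have [s ->] := bc_span y; elim/big_ind: _ => // p _.
Qed.

Lemma bc_hom_ext M (N : lmodType S) (w w' : {linear F M -> N}) :
  (forall x, w (bc_unit F x) = w' (bc_unit F x)) -> w =1 w'.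
Proof.
move=> ww' y; elim/bc_ind: y => [|x y IHx IHy|s x]; first by rewrite !raddf0.
  by rewrite !raddfD /= IHx IHy.
by rewrite !linearZ /= ww'.
Qed.

Lemma bc_map_exists M N (f : {linear M -> N}) :
  exists w : {linear F M -> F N}, forall x, w (bc_unit F x) = bc_unit F (f x).
Proof.
apply: bc_extend => [x y|r x]; first by rewrite raddfD bc_unitD.
by rewrite linearZ /= bc_unitZ.
Qed.

Definition bc_map M N (f : {linear M -> N}) : {linear F M -> F N} :=
  sval (cid (bc_map_exists f)).

Lemma bc_map_unit M N (f : {linear M -> N}) x :
  bc_map f (bc_unit F x) = bc_unit F (f x).
Proof. exact: (svalP (cid (bc_map_exists f))). Qed.

Lemma bc_map_comp L M N (f : {linear L -> M}) (g : {linear M -> N})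
    (h : {linear L -> N}) :
  (forall x, g (f x) = h x) -> forall y, bc_map g (bc_map f y) = bc_map h y.
Proof.
move=> gfh; apply: (bc_hom_ext (w := bc_map g \o bc_map f)) => x /=.
by rewrite !bc_map_unit gfh.
Qed.

Lemma bc_map0 M N (f : {linear M -> N}) y : (forall x, f x = 0) -> bc_map f y = 0.
Proof.
move=> f0; apply: (bc_hom_ext (w' := \0)) y => x /=.
by rewrite bc_map_unit f0 (additive0 (@bc_unitD _ _ _ F N)).
Qed.

Lemma bc_mod0 M : (forall x : M, x = 0) -> forall y : F M, y = 0.
Proof.
move=> M0 y; have -> : y = idfun y by [].
have -> : (idfun : {linear F M -> F M}) y = bc_map idfun y.
  by apply: (bc_hom_ext (w := idfun)) => x; rewrite bc_map_unit.
by apply: bc_map0 => x; rewrite [LHS]M0.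
Qed.

Definition bc_exact : Prop := forall L M N (f : {linear L -> M}) (g : {linear M -> N}),
  short_exact f g -> short_exact (bc_map f) (bc_map g).

Hypothesis F_exact : bc_exact.

Lemma bc_map_surj M N (g : {linear M -> N}) :
  (forall z, exists y, g y = z) -> forall z, exists y, bc_map g y = z.
Proof.
move=> g_surj; pose i := ker_incl g.
have [] // := F_exact (f := i) (g := g).
by split=> // [x y /val_inj | y]; rewrite ?kermodP.
Qed.

Lemma bc_map_inj M N (f : {linear M -> N}) : injective f -> injective (bc_map f).
Proof.
move=> f_inj; have [p [p_surj p_ker]] := coker_projection f.
by have [] := F_exact (f := f) (g := p).
Qed.

(** An exact sequence [L -> M -> N] splits into a surjection of [L] onto the
    kernel of [g], the short exact sequence of that kernel, and an injection of
    its cokernel into [N]; an exact functor preserves all three. *)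
Lemma bc_map_exact L M N (f : {linear L -> M}) (g : {linear M -> N}) :
  (forall y, g y = 0 <-> exists x, f x = y) ->
  forall y, bc_map g y = 0 <-> exists x, bc_map f x = y.
Proof.
move=> ex.
have gf0 x : g (f x) = 0 by apply/ex; exists x.
have [f' f'E] := ker_factor gf0.
pose i := ker_incl g.
have [p [p_surj p_ker]] := coker_projection i.
have [_ F_ex _] : short_exact (bc_map i) (bc_map p).
  by apply: F_exact; split=> // x y /val_inj.
have f'_surj k : exists x, f' x = k.
  have /ex[x fx] : g (kermod_val k) = 0 by apply/kermodP; exists k.
  by exists x; apply/val_inj; rewrite /= f'E.
have [s sE] := choice p_surj.
have gsE y : g (s (p y)) = g y.
  apply/eqP; rewrite -subr_eq0 -raddfB; apply/eqP/kermodP/p_ker.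
  by rewrite raddfB /= sE subrr.
(* [j] is the injection of M / ker g into N induced by [g]. *)
pose j z := g (s z).
have jD : {morph j : x y / x + y}.
  move=> x y; rewrite /j -[x in LHS]sE -[y in LHS]sE -(raddfD p) gsE.
  by rewrite raddfD.
have jZ a x : j (a *: x) = a *: j x.
  have pa : p (a *: s x) = a *: x by rewrite linearZ /= sE.
  by rewrite /j -[in LHS]pa gsE linearZ.
pose jl := mk_linear jD jZ.
have j_inj : injective jl.
  move=> x y /eqP; rewrite -subr_eq0 -raddfB => /eqP /= /kermodP/p_ker.
  by rewrite sE => /eqP; rewrite subr_eq0 => /eqP.
have jpg : forall x, jl (p x) = g x by [].
have ifE : forall x, i (f' x) = f x by [].
move=> y; rewrite -(bc_map_comp jpg).
have -> : bc_map jl (bc_map p y) = 0 <-> bc_map p y = 0.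
  by split=> [|->]; rewrite ?raddf0 // => jp0; apply: (bc_map_inj j_inj); rewrite jp0 raddf0.
rewrite F_ex; split=> [[k <-]|[x <-]].
  have [x <-] := bc_map_surj f'_surj k; exists x.
  by rewrite (bc_map_comp ifE).
by exists (bc_map f' x); rewrite (bc_map_comp ifE).
Qed.

Lemma bc_homology (X Y Z H : lmodType R) (f : {linear X -> Y}) (g : {linear Y -> Z}) :
  (forall x, g (f x) = 0) -> homology_of H f g ->
  homology_of (F H) (bc_map f) (bc_map g).
Proof.
move=> gf0 [K [i [q [i_inj i_im q_surj q_ker]]]].
exists (F K), (bc_map i), (bc_map q); split.
- exact: bc_map_inj.
- exact: bc_map_exact.
- exact: bc_map_surj.
have /choice[t tE] x : exists k, i k = f x by exact/i_im.
have tD : {morph t : x y / x + y}.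
  by move=> x y; apply: i_inj; rewrite raddfD /= !tE raddfD.
have tZ a x : t (a *: x) = a *: t x.
  by apply: i_inj; rewrite linearZ /= !tE linearZ.
pose tl := mk_linear tD tZ.
have itE : forall x, i (tl x) = f x by exact: tE.
have tl_ex k : q k = 0 <-> exists x, tl x = k.
  rewrite q_ker; split=> -[x xE]; exists x; last by rewrite -xE -itE.
  by apply: i_inj; rewrite itE xE.
move=> k; rewrite (bc_map_exact tl_ex); split=> -[x xE]; exists x.
  by rewrite -xE (bc_map_comp itE).
by apply: (bc_map_inj i_inj); rewrite (bc_map_comp itE) xE.
Qed.

End BaseChangeFunctor.

(** The ring map is a parameter of the type, so that the modules obtained
    from [N] along different maps stay apart. *)
Definition restrict_scalars (R S : pzRingType) (psi : {rmorphism R -> S})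
  (N : lmodType S) : Type := N.

Section RestrictScalars.
Variables (R S : pzRingType) (psi : {rmorphism R -> S}) (N : lmodType S).
Local Notation res := (restrict_scalars psi N).

HB.instance Definition _ := GRing.Zmodule.on res.

Definition restrict_scale (r : R) (x : res) : res :=
  psi r *: (x : N).

Fact restrict_scaleA r s x :
  restrict_scale r (restrict_scale s x) = restrict_scale (r * s) x.
Proof. by rewrite /restrict_scale rmorphM scalerA. Qed.
Fact restrict_scale1 : left_id 1 restrict_scale.
Proof. by move=> x; rewrite /restrict_scale rmorph1 scale1r. Qed.
Fact restrict_scaleDr : right_distributive restrict_scale +%R.
Proof. by move=> r x y; exact: scalerDr. Qed.
Fact restrict_scaleDl x : {morph restrict_scale^~ x : r s / r + s}.
Proof. by move=> r s; rewrite /restrict_scale rmorphD scalerDl. Qed.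

HB.instance Definition _ := GRing.Zmodule_isLmodule.Build R res
  restrict_scaleA restrict_scale1 restrict_scaleDr restrict_scaleDl.
End RestrictScalars.

Section BaseChangeResolution.
Variables (R S : pzRingType) (psi : {rmorphism R -> S}) (F : base_change psi).
Implicit Types M P : lmodType R.

(** Base change is left adjoint to restriction of scalars, which preserves
    surjections. *)
Lemma bc_projective P : projective P -> projective (F P).
Proof.
move=> P_proj M N g f g_surj.
pose M' : lmodType R := restrict_scalars psi M.
pose N' : lmodType R := restrict_scalars psi N.
have gZ a (x : M) : g (psi a *: x) = psi a *: g x by rewrite linearZ.
pose g' : {linear M' -> N'} := @mk_linear R M' N' g (raddfD g) gZ.
have fZ a (x : P) : f (bc_unit F (a *: x)) = psi a *: f (bc_unit F x).
  by rewrite bc_unitZ linearZ.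
have fD (x y : P) : f (bc_unit F (x + y)) = f (bc_unit F x) + f (bc_unit F y).
  by rewrite bc_unitD raddfD.
pose f' : {linear P -> N'} := @mk_linear R P N' (fun x => f (bc_unit F x)) fD fZ.
have [h hE] := P_proj M' N' g' f' g_surj.
have [w wE] : exists w : {linear F P -> M}, forall x, w (bc_unit F x) = h x.
  apply: (@bc_extend _ _ _ F P M (fun x => h x : M)) => [x y|r x]; first by rewrite raddfD.
  by rewrite linearZ.
by exists w => y; apply: (bc_hom_ext (w := g \o w)) y => x /=; rewrite wE hE.
Qed.

Lemma bc_fin_gen P : fin_gen P -> fin_gen (F P).
Proof.
case=> n [e eP]; exists n, (fun i => bc_unit F (e i)).
elim/bc_ind => [|x y [c ->] [c' ->]|s x].
- by exists (fun _ => 0); rewrite big1 // => i _; rewrite scale0r.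
- exists (fun i => c i + c' i); rewrite -big_split.
  by apply: eq_bigr => i _; rewrite scalerDl.
have [c ->] := eP x; exists (fun i => s * psi (c i)).
have u0 : bc_unit F (0 : P) = 0 by exact: additive0 (@bc_unitD _ _ _ F P).
rewrite (big_morph (bc_unit F) (@bc_unitD _ _ _ F P) u0) scaler_sumr.
by apply: eq_bigr => i _; rewrite bc_unitZ scalerA.
Qed.

Hypothesis F_exact : bc_exact F.

Section Resolution.
Variables (M : lmodType R) (N : lmodType S) (t : {linear F M -> N}).
Hypothesis t_bij : bijective t.
Variable P : proj_resolution M.

Let aug : {linear F (P 0) -> N} := t \o bc_map F (res_aug P).

Lemma bc_aug_surj y : exists x, aug x = y.
Proof.
have [t' tK t'K] := t_bij.
have [x xE] := bc_map_surj F_exact (@res_aug_surj _ _ P) (t' y).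
by exists x; rewrite /= xE t'K.
Qed.

Lemma bc_res_exact0 x : aug x = 0 <-> exists y, bc_map F (res_d P 0) y = x.
Proof.
rewrite -(bc_map_exact F_exact (@res_exact0 _ _ P)) /=.
split=> [ax0|->]; last exact: raddf0.
by apply: (bij_inj t_bij); rewrite ax0 raddf0.
Qed.

Definition bc_resolution : proj_resolution N :=
  ProjResolution (fun n => bc_projective (@res_proj _ _ P n))
    bc_aug_surj bc_res_exact0
    (fun n => bc_map_exact F_exact (@res_exact _ _ P n)).

End Resolution.

Lemma bc_fg_proj_resolvable M N :
  lmod_iso (F M) N -> fg_proj_resolvable M -> fg_proj_resolvable N.
Proof.
case=> t t_bij [P P_fg]; exists (bc_resolution t_bij P) => n.
exact: bc_fin_gen.
Qed.

Lemma bc_fin_proj_dim M N :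
  lmod_iso (F M) N -> fin_proj_dim M -> fin_proj_dim N.
Proof.
case=> t t_bij [P [n Pn0]]; exists (bc_resolution t_bij P), n => i ni.
exact/bc_mod0/Pn0.
Qed.

End BaseChangeResolution.

(** * Base change of duals and of Ext *)

(** The coordinates of a section of a surjection from a finite free module. *)
Lemma dual_basis (R : pzRingType) (P : lmodType R) : projective P -> fin_gen P ->
  exists n (e : 'I_n -> P) (c : 'I_n -> dual P),
    forall x, x = \sum_(i < n) dual_fun (c i) x *: e i.
Proof.
move=> P_proj [n [e e_span]].
have fextI f : fext e f = \sum_(i < n) (f i : R) *: e i.
  by apply: fextE; [exact: index_enum_uniq | move=> i _; exact: mem_index_enum].
have e_surj y : exists x, fext e x = y.
  have [a ->] := e_span y; exists (\sum_(i < n) a i *: fdelta R i).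
  rewrite raddf_sum; apply: eq_bigr => i _.
  by rewrite [LHS](linearZZ (fext e)); congr (_ *: _); exact: fext_delta.
have [h hE] := P_proj _ _ (fext e) idfun e_surj.
have c_linear i : linear (fun x => h x i : R^o).
  by move=> a x y; rewrite linearP.
exists n, e, (fun i => HB.pack_for {linear P -> R^o} (fun x => h x i : R^o)
  (GRing.isLinear.Build R P R^o *:%R (fun x => h x i : R^o) (c_linear i))).
by move=> x; apply: etrans (fextI (h x)); apply/esym; exact: hE.
Qed.

Lemma dual_fun_sum (R : pzRingType) (P : lmodType R) n (f : 'I_n -> dual P) x :
  dual_fun (\sum_(i < n) f i) x = \sum_(i < n) dual_fun (f i) x.
Proof. by apply: (big_morph (fun f : dual P => dual_fun f x)). Qed.

Lemma dual_fun_lincomb (R : pzRingType) (P : lmodType R) n (f : dual P) a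
    (e : 'I_n -> P) :
  dual_fun f (\sum_(i < n) a i *: e i) = \sum_(i < n) a i * dual_fun f (e i).
Proof.
rewrite /dual_fun raddf_sum; apply: eq_bigr => i _.
exact: (linearZZ (f : {linear P -> R^o})).
Qed.

Section BaseChangeDual.
Variables (R S : pzRingType) (psi : {rmorphism R -> S}) (F : base_change psi).
Variable F' : base_change (psi : R^c -> S^c).
Implicit Types P Q : lmodType R.

Lemma bc_dual_ext P (w w' : dual (F P)) :
  (forall x, dual_fun w (bc_unit F x) = dual_fun w' (bc_unit F x)) -> w = w'.
Proof.
move=> ww'; apply: dual_ext.
exact: (@bc_hom_ext _ _ _ F P S^o (w : {linear F P -> S^o}) w' ww').
Qed.

(** The natural map Hom_R(P, R) (x)_R S -> Hom_S(S (x)_R P, S): a functional [f]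
    on [P] extends to the base change of [P] through psi \o f. *)
Lemma bc_dual_exists P : exists t : {linear F' (dual P) -> dual (F P)},
  forall f x, dual_fun (t (bc_unit F' f)) (bc_unit F x) = psi (dual_fun f x).
Proof.
have /choice[v vE] (f : dual P) : exists w : dual (F P),
    forall x, dual_fun w (bc_unit F x) = psi (dual_fun f x).
  have [x y|r x|w wE] := @bc_extend _ _ _ F P S^o (fun x => psi (dual_fun f x)).
  - by rewrite /dual_fun !raddfD.
  - by rewrite /dual_fun linearZ /= rmorphM.
  by exists w.
have [||t tE] := @bc_extend _ _ _ F' _ _ v.
- move=> f g; apply: bc_dual_ext => x; rewrite vE.
  by apply: etrans (raddfD psi (dual_fun f x) (dual_fun g x)) _; rewrite /= -!vE.
- move=> r f; apply: bc_dual_ext => x; rewrite vE.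
  by apply: etrans (rmorphM psi (dual_fun f x) r) _; rewrite -!vE.
by exists t => f x; rewrite tE vE.
Qed.

Definition bc_dual P : {linear F' (dual P) -> dual (F P)} :=
  sval (cid (bc_dual_exists P)).

Lemma bc_dualE P (f : dual P) x :
  dual_fun (bc_dual P (bc_unit F' f)) (bc_unit F x) = psi (dual_fun f x).
Proof. exact: (svalP (cid (bc_dual_exists P))). Qed.

Lemma bc_dual_natural P Q (e : {linear P -> Q}) y :
  dual_map (bc_map F e) (bc_dual Q y) = bc_dual P (bc_map F' (dual_map e) y).
Proof.
apply: (bc_hom_ext (w := dual_map (bc_map F e) \o bc_dual Q)
          (w' := bc_dual P \o bc_map F' (dual_map e))) y => f /=.
apply: bc_dual_ext => x.
by rewrite -!/(dual_fun _ _) bc_map_unit bc_dualE /dual_fun /= bc_map_unit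
  -!/(dual_fun _ _) bc_dualE.
Qed.

(** For a dual basis (e_i, c_i) of [P], the inverse of the natural map sends [g]
    to the sum of the c_i (x) g(1 (x) e_i). *)
Lemma bc_dual_bij P : projective P -> fin_gen P ->
  injective (bc_dual P) /\ (forall g, exists y, bc_dual P y = g).
Proof.
move=> P_proj P_fg; have [n [e [c ec]]] := dual_basis P_proj P_fg.
pose k (g : dual (F P)) : F' (dual P) :=
  \sum_(i < n) (dual_fun g (bc_unit F (e i)) : S^c) *: bc_unit F' (c i).
have kD g g' : k (g + g') = k g + k g'.
  rewrite -big_split; apply: eq_bigr => i _.
  exact: (scalerDl _ (dual_fun g _ : S^c) (dual_fun g' _)).
have kZ s g : k (s *: g) = s *: k g.
  by rewrite scaler_sumr; apply: eq_bigr => i _; rewrite scalerA.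
have u'0 : bc_unit F' (0 : dual P) = 0 by exact: additive0 (@bc_unitD _ _ _ F' _).
have u0 : bc_unit F (0 : P) = 0 by exact: additive0 (@bc_unitD _ _ _ F P).
have kK y : k (bc_dual P y) = y.
  elim/bc_ind: y => [|x y IHx IHy|s f].
  - by rewrite raddf0 /k big1 // => i _; rewrite scale0r.
  - by rewrite raddfD /= kD IHx IHy.
  rewrite linearZ /= kZ; congr (_ *: _).
  transitivity (\sum_(i < n) bc_unit F' ((dual_fun f (e i) : R^c) *: c i)).
    by apply: eq_bigr => i _; rewrite bc_dualE bc_unitZ.
  rewrite -(big_morph (bc_unit F') (@bc_unitD _ _ _ F' _) u'0); congr bc_unit.
  apply: dual_ext => x.
  by rewrite dual_fun_sum [in RHS](ec x) dual_fun_lincomb; apply: eq_bigr.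
split=> [|g]; first exact: can_inj kK.
exists (k g); apply: bc_dual_ext => x.
rewrite [in RHS](ec x) (big_morph (bc_unit F) (@bc_unitD _ _ _ F _) u0).
rewrite raddf_sum dual_fun_sum.
under [in RHS]eq_bigr do rewrite bc_unitZ.
rewrite dual_fun_lincomb; apply: eq_bigr => i _; rewrite -bc_dualE.
exact: (congr1 (fun w => dual_fun w (bc_unit F x)) (linearZZ (bc_dual P) _ _)).
Qed.

Hypotheses (F_exact : bc_exact F) (F'_exact : bc_exact F').

(** If P -> M is a resolution by finitely generated projectives, its base change
    resolves [N], and Hom_S(F P, S) is the base change of the complex
    Hom_R(P, R). Since base change is exact, it commutes with the cohomology of
    that complex. *)
Theorem bc_Ext M N n : lmod_iso (F M) N -> fg_proj_resolvable M ->
  lmod_iso (F' (Ext M n)) (Ext N n).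
Proof.
case=> t t_bij [P P_fg].
have := homology_of_Ext P n => /(bc_homology F'_exact) [].
  by move=> x; apply: dual_ext => z; rewrite /dual_fun /= res_pdd raddf0.
move=> K [i [q [i_inj i_im q_surj q_ker]]].
pose Q := bc_resolution F_exact t_bij P.
suff : homology_of (F' (Ext M n)) (dual_map (res_pd Q n)) (dual_map (res_d Q n)).
  move=> HQ; apply: (homology_of_map_iso (u := idfun)) HQ (homology_of_Ext Q n) => //.
  - by move=> x; exists x.
  - by move=> y y0; exists y; split=> //; exists 0; rewrite raddf0 subrr.
have pdE x : res_pd Q n x = bc_map F (res_pd P n) x.
  by case: n x {i i_im i_inj q q_surj q_ker} => // x; rewrite bc_map0.
have [tau_inj tau_surj] := bc_dual_bij (@res_proj _ _ P n) (P_fg n).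
exists K, (bc_dual (P n) \o i), q; split=> //=.
- exact: inj_comp.
- move=> y; have [z <-] := tau_surj y.
  have [tau1_inj _] := bc_dual_bij (@res_proj _ _ P n.+1) (P_fg n.+1).
  rewrite bc_dual_natural; split=> [|[k /tau_inj kz]].
    rewrite -(raddf0 (bc_dual (P n.+1))) => /tau1_inj /i_im[k <-].
    by exists k.
  have /i_im-> : exists k, i k = z by exists k.
  exact: raddf0.
move=> k; rewrite q_ker.
have d_pdE x : dual_map (res_pd Q n) x = dual_map (bc_map F (res_pd P n)) x.
  by apply: dual_ext => z; rewrite /dual_fun /= pdE.
split=> [[x xE]|[y]].
  by exists (bc_dual (P n.-1) x); rewrite d_pdE bc_dual_natural xE.
have [_ tau1_surj] := bc_dual_bij (@res_proj _ _ P n.-1) (P_fg n.-1).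
have [x <-] := tau1_surj y.
by rewrite d_pdE bc_dual_natural => /tau_inj <-; exists x.
Qed.

End BaseChangeDual.
(** * Bimodules as modules over the enveloping algebra *)

Record bimod_hom (k : fieldType) (A C : algebra k) (M N : bimod A C) (f : M -> N) :
    Prop := BimodHom {
  hom_D : {morph f : x y / x + y};
  hom_lact : forall a x, f (lact a x) = lact a (f x);
  hom_ract : forall x c, f (ract x c) = ract (f x) c
}.

Section TensorActions.
Variables (k : fieldType) (A B C : algebra k) (M : bimod A B) (N : bimod B C).

Lemma lact_pure a m n : lact a (pure m n : tens M N) = pure (lact a m) n.
Proof. exact: tens_lact_pure. Qed.

Lemma ract_pure m n c : ract (pure m n : tens M N) c = pure m (ract n c).
Proof. exact: tens_ract_pure. Qed.

Lemma lact0 a : lact a (0 : M) = 0.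
Proof. exact: additive0 (lactDr a). Qed.

Lemma ract0 b : ract (0 : M) b = 0.
Proof. by apply: (additive0 (f := fun x => ract x b)) => x y; exact: ractDl. Qed.
End TensorActions.

Section OneSidedModules.
Variables (k : fieldType) (A C : algebra k) (M : bimod A C).

Definition lact_mod : Type := M.
HB.instance Definition _ := GRing.Zmodule.on lact_mod.
HB.instance Definition _ := GRing.Zmodule_isLmodule.Build A lact_mod
  (fun a b m => esym (@lactM k A C M a b m)) (@lact1 k A C M)
  (@lactDr k A C M) (fun m a b => @lactDl k A C M a b m).

Definition ract_mod : Type := M.
HB.instance Definition _ := GRing.Zmodule.on ract_mod.
HB.instance Definition _ := GRing.Zmodule_isLmodule.Build C^c ract_mod
  (fun a b m => esym (@ractM k A C M m b a)) (@ract1 k A C M)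
  (fun a m n => @ractDl k A C M m n a) (@ractDr k A C M).
End OneSidedModules.

Section Enveloping.
Variables (k : fieldType) (A : algebra k).

Lemma epureE (a b : A) : epure a b = epure a 1 * epure 1 b.
Proof. by rewrite [RHS]env_mul_pure mulr1 mulr1. Qed.

Lemma epureC (a b : A) : epure a b = epure 1 b * epure a 1.
Proof. by rewrite [RHS]env_mul_pure mul1r mul1r. Qed.

Lemma env_additive_ext (V : zmodType) (f g : env A -> V) :
  {morph f : x y / x + y} -> {morph g : x y / x + y} ->
  (forall a b, f (epure a b) = g (epure a b)) -> f =1 g.
Proof.
move=> fD gD fg x; elim/tensor_ind: x => [|x y IHx IHy|a b]; last exact: fg.
  by rewrite !additive0.
by rewrite fD gD IHx IHy.
Qed.

Program Definition bimod_of_left (E : lmodType (env A)) : bimod A A :=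
  @Bimod k A A E (fun a m => epure a 1 *: m) (fun m b => epure 1 b *: m)
    _ _ _ _ _ _ _ _ _ _.
Next Obligation. by rewrite -scalerDl /epure pureDl. Qed.
Next Obligation. exact: scalerDr. Qed.
Next Obligation. exact: scale1r. Qed.
Next Obligation.
by rewrite [RHS]scalerA; congr (_ *: _); rewrite [RHS]env_mul_pure mul1r.
Qed.
Next Obligation. exact: scalerDr. Qed.
Next Obligation. by rewrite -scalerDl /epure pureDr. Qed.
Next Obligation. exact: scale1r. Qed.
Next Obligation.
by rewrite [RHS]scalerA; congr (_ *: _); rewrite [RHS]env_mul_pure mul1r.
Qed.
Next Obligation. by rewrite !scalerA -epureE -epureC. Qed.
Next Obligation.
congr (_ *: _); have := @epure_bal k A 1 c 1.
by rewrite mul1r mulr1.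
Qed.

Lemma bimod_of_leftE (E : lmodType (env A)) a b (x : bimod_of_left E) :
  lact a (ract x b) = epure a b *: (x : E).
Proof. by rewrite [LHS]scalerA -epureE. Qed.

Lemma bimod_of_rightE (E : lmodType (env A)^c) a b (x : bimod_of_right E) :
  lact a (ract x b) = (epure b a : (env A)^c) *: (x : E).
Proof. by rewrite [LHS]scalerA [(_ * _)%R]env_mul_pure !mulr1. Qed.

Definition env_swap : env A -> env A := tlift (fun a b => epure b a).

Let env_swap_bal (a : A) (c : k) (b : A) :
  epure b (kract a c) = epure (klact c b) a.
Proof. by rewrite /kract /klact -!alg_central -epure_bal alg_central. Qed.

Lemma env_swap_pure a b : env_swap (epure a b) = epure b a.
Proof.
apply: (tlift_pure (f := fun a b => epure b a)) => *; last exact: env_swap_bal.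
  by rewrite /epure pureDr.
by rewrite /epure pureDl.
Qed.

Lemma env_swapD : {morph env_swap : x y / x + y}.
Proof.
apply: tliftD => *; last exact: env_swap_bal.
  by rewrite /epure pureDr.
by rewrite /epure pureDl.
Qed.

Lemma env_swapM x y : env_swap (x * y) = env_swap y * env_swap x.
Proof.
move: x; apply: env_additive_ext => [x x'|x x'|a b].
- by rewrite mulrDl env_swapD.
- by rewrite env_swapD mulrDr.
move: y; apply: env_additive_ext => [y y'|y y'|a' b'].
- by rewrite mulrDr env_swapD.
- by rewrite env_swapD mulrDl.
by rewrite [epure a b * _]env_mul_pure !env_swap_pure [RHS]env_mul_pure.
Qed.

Section RightEnvMod.
Variable M : bimod A A.

(** A bimodule as a right A^e-module: m (a (x) b) = b m a. It is obtained
    from the left module structure through the anti-automorphism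
    a (x) b |-> b (x) a of A^e, and is inverse to [bimod_of_right]. *)
Definition renv_mod : Type := M.
HB.instance Definition _ := GRing.Zmodule.on renv_mod.

Definition renv_scale (x : (env A)^c) (m : renv_mod) : renv_mod :=
  @env_scale k A M (env_swap x) m.

Fact renv_scaleA x y m : renv_scale x (renv_scale y m) = renv_scale (x * y) m.
Proof. by rewrite /renv_scale env_scaleA -env_swapM. Qed.
Fact renv_scale1 : left_id 1 renv_scale.
Proof. by move=> m; rewrite /renv_scale [env_swap _]env_swap_pure env_scale1. Qed.
Fact renv_scaleDr : right_distributive renv_scale +%R.
Proof. by move=> x m n; exact: env_scaleDr. Qed.
Fact renv_scaleDl m : {morph renv_scale^~ m : x y / x + y}.
Proof. by move=> x y; rewrite /renv_scale env_swapD env_scaleDl. Qed.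

HB.instance Definition _ := GRing.Zmodule_isLmodule.Build (env A)^c renv_mod
  renv_scaleA renv_scale1 renv_scaleDr renv_scaleDl.

Lemma renv_scale_pure a b (m : M) :
  (epure a b : (env A)^c) *: (m : renv_mod) = lact b (ract m a) :> M.
Proof. by rewrite -[RHS]env_scale_pure -[epure b a]env_swap_pure. Qed.
End RightEnvMod.

End Enveloping.

Section EnvelopingMap.
Variables (k : fieldType) (A B : algebra k) (phi : alg_hom A B).

Definition env_map : env A -> env B := tmap phi phi.

Let phi_kract (a : A) (c : k) : phi (kract a c) = kract (phi a) c.
Proof. by rewrite /kract rmorphM alg_hom_str. Qed.
Let phi_klact (c : k) (a : A) : phi (klact c a) = klact c (phi a).
Proof. by rewrite /klact rmorphM alg_hom_str. Qed.

Lemma env_map_pure a b : env_map (epure a b) = epure (phi a) (phi b).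
Proof. by apply: tmap_pure => //; exact: raddfD. Qed.

Lemma env_mapD : {morph env_map : x y / x + y}.
Proof. by apply: tmapD => //; exact: raddfD. Qed.

Lemma env_mapM : {morph env_map : x y / x * y}.
Proof.
move=> x y; move: x; apply: env_additive_ext => [x x'|x x'|a b].
- by rewrite mulrDl env_mapD.
- by rewrite env_mapD mulrDl.
move: y; apply: env_additive_ext => [y y'|y y'|a' b'].
- by rewrite mulrDr env_mapD.
- by rewrite env_mapD mulrDr.
by rewrite [epure a b * _]env_mul_pure !env_map_pure [RHS]env_mul_pure !rmorphM.
Qed.

Lemma env_map1 : env_map 1 = 1.
Proof. by rewrite [LHS]env_map_pure !rmorph1. Qed.

HB.instance Definition _ := GRing.isNmodMorphism.Build (env A) (env B) env_map
  (conj (additive0 env_mapD) env_mapD).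
HB.instance Definition _ := GRing.isMonoidMorphism.Build (env A) (env B) env_map
  (conj env_map1 env_mapM).

End EnvelopingMap.

(** * Two-sided base change *)

Section TwoSidedBaseChange.
Variables (k : fieldType) (A B : algebra k) (phi : alg_hom A B).

Definition bichange (M : bimod A A) : bimod B B :=
  tens (tens (bimodBA phi) M) (bimodAB phi).

Section Unit.
Variable M : bimod A A.

Definition bichange_unit (m : M) : bichange M :=
  pure (pure (1 : B) m : tens (bimodBA phi) M) (1 : B).

Lemma bichange_unitD : {morph bichange_unit : x y / x + y}.
Proof. by move=> x y; rewrite /bichange_unit pureDr pureDl. Qed.

Lemma bichange_unit_lact a m :
  bichange_unit (lact a m) = lact (phi a) (bichange_unit m).
Proof.
rewrite /bichange_unit !lact_pure -pure_bal.
by congr (pure (pure _ _) _); rewrite /= mul1r mulr1.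
Qed.

Lemma bichange_unit_ract m a :
  bichange_unit (ract m a) = ract (bichange_unit m) (phi a).
Proof.
rewrite /bichange_unit ract_pure.
have -> : ract (1 : bimodAB phi) (phi a) = lact a (1 : bimodAB phi).
  by rewrite /= mul1r mulr1.
by rewrite -pure_bal ract_pure.
Qed.

Lemma bichange_ind (Pr : bichange M -> Prop) : Pr 0 ->
  (forall x y, Pr x -> Pr y -> Pr (x + y)) ->
  (forall b m b', Pr (lact b (ract (bichange_unit m) b'))) -> forall y, Pr y.
Proof.
move=> P0 PD Pp y; elim/tensor_ind: y => // t b'.
elim/tensor_ind: t => [|x y Px Py|b m]; first by rewrite pure0n.
  by rewrite pureDl; exact: PD.
move: (Pp b m b').
by rewrite /bichange_unit ract_pure !lact_pure /= mulr1 mul1r.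
Qed.

(** A semilinear map [v] extends by b (x) m (x) b' |-> b v(m) b'. *)
Lemma bichange_extend (N : bimod B B) (v : M -> N) :
  {morph v : x y / x + y} -> (forall a x, v (lact a x) = lact (phi a) (v x)) ->
  (forall x a, v (ract x a) = ract (v x) (phi a)) ->
  exists w : bichange M -> N, bimod_hom w /\ forall x, w (bichange_unit x) = v x.
Proof.
move=> vD vl vr.
pose w1 : tens (bimodBA phi) M -> N := tlift (fun (b : B) m => lact b (v m)).
have [w1p w1D] : (forall b m, w1 (pure b m) = lact b (v m)) /\
    {morph w1 : x y / x + y}.
  have h1 (m m' : B) n : lact (m + m') (v n) = lact m (v n) + lact m' (v n).
    exact: lactDl.
  have h2 (m : B) n n' : lact m (v (n + n')) = lact m (v n) + lact m (v n').
    by rewrite vD lactDr.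
  have h3 m r n : lact (ract (m : bimodBA phi) r : B) (v n) = lact m (v (lact r n)).
    by rewrite /= vl lactM.
  split=> [b m|]; first exact: (tlift_pure h1 h2 h3).
  exact: (tliftD h1 h2 h3).
have w1l b t : w1 (lact b t) = lact b (w1 t).
  elim/tensor_ind: t => [|x y IHx IHy|b' m].
  - by rewrite lact0 !(additive0 w1D) lact0.
  - by rewrite lactDr !w1D lactDr IHx IHy.
  - by rewrite lact_pure !w1p /= lactM.
have w1r t a : w1 (ract t a) = ract (w1 t) (phi a).
  elim/tensor_ind: t => [|x y IHx IHy|b' m].
  - by rewrite ract0 !(additive0 w1D) ract0.
  - by rewrite ractDl !w1D ractDl IHx IHy.
  - by rewrite ract_pure !w1p vr lractA.
pose w : bichange M -> N := tlift (fun t (b : B) => ract (w1 t) b).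
have [wp wD] : (forall t b, w (pure t b) = ract (w1 t) b) /\
    {morph w : x y / x + y}.
  have h1 t t' (b : B) : ract (w1 (t + t')) b = ract (w1 t) b + ract (w1 t') b.
    by rewrite w1D ractDl.
  have h2 t (b b' : B) : ract (w1 t) (b + b') = ract (w1 t) b + ract (w1 t) b'.
    exact: ractDr.
  have h3 t r (b : B) : ract (w1 (ract t r)) b = ract (w1 t) (lact r (b : bimodAB phi)).
    by rewrite w1r /= ractM.
  split=> [b m|]; first exact: (tlift_pure h1 h2 h3).
  exact: (tliftD h1 h2 h3).
exists w; split; last by move=> x; rewrite wp ract1 w1p lact1.
split=> // [b y|y b].
  elim/tensor_ind: y => [|x y IHx IHy|t b'].
  - by rewrite lact0 !(additive0 wD) lact0.
  - by rewrite lactDr !wD lactDr IHx IHy.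
  - by rewrite lact_pure !wp w1l lractA.
elim/tensor_ind: y => [|x y IHx IHy|t b'].
- by rewrite ract0 !(additive0 wD) ract0.
- by rewrite ractDl !wD ractDl IHx IHy.
- by rewrite ract_pure !wp /= ractM.
Qed.

End Unit.

Definition bichange_map (M N : bimod A A) (f : M -> N) : bichange M -> bichange N :=
  tmap (tmap id f : tens (bimodBA phi) M -> tens (bimodBA phi) N) id.

Section Map.
Variables (M N : bimod A A) (f : M -> N).
Hypothesis f_hom : bimod_hom f.

Let fl : tens (bimodBA phi) M -> tens (bimodBA phi) N := tmap id f.
Lemma tens_map_pure b m : fl (pure b m) = pure b (f m).
Proof. by apply: (tmap_pure (f := id) (g := f)) => //; case: f_hom. Qed.
Lemma tens_mapD : {morph fl : x y / x + y}.
Proof. by apply: (tmapD (f := id) (g := f)) => //; case: f_hom. Qed.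
Lemma tens_map_ract t a : fl (ract t a) = ract (fl t) a.
Proof.
elim/tensor_ind: t => [|x y IHx IHy|b m].
- by rewrite ract0 (additive0 tens_mapD) ract0.
- by rewrite ractDl !tens_mapD ractDl IHx IHy.
- by rewrite ract_pure !tens_map_pure ract_pure (hom_ract f_hom).
Qed.

Lemma bichange_mapD : {morph bichange_map f : x y / x + y}.
Proof. by apply: (tmapD tens_mapD) => // t a; exact: tens_map_ract. Qed.

Lemma bichange_map_unit b m b' :
  bichange_map f (lact b (ract (bichange_unit m) b')) =
  lact b (ract (bichange_unit (f m)) b').
Proof.
rewrite /bichange_unit !ract_pure !lact_pure.
by rewrite -tens_map_pure; apply: (tmap_pure tens_mapD) => // t a; exact: tens_map_ract.
Qed.
End Map.

Section Exactness.
Hypotheses (left_exact : left_tensor_exact phi).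
Hypotheses (right_exact : right_tensor_exact phi).

(** Tensor a short exact sequence first with [B] on the left, as left
    [A]-modules, then with [B] on the right, as right [A]-modules. *)
Lemma bichange_exact (L M N : bimod A A) (f : L -> M) (g : M -> N) :
  bimod_hom f -> bimod_hom g -> short_exact f g ->
  short_exact (bichange_map f) (bichange_map g).
Proof.
move=> f_hom g_hom ex.
(* The module structures on [lact_mod X] and [ract_mod X] repackage the additive
   group of [X]; on an explicit record the two groups are convertible. *)
destruct L as [[L []]], M as [[M []]], N as [[N []]].
pose lin (X Y : bimod A A) (e : X -> Y) (e_hom : bimod_hom e) :
    {linear lact_mod X -> lact_mod Y} :=
  @mk_linear A (lact_mod X) (lact_mod Y) e (hom_D e_hom) (hom_lact e_hom).
have ex1 := left_exact (f := lin _ _ _ f_hom) (g := lin _ _ _ g_hom) ex.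
pose rin (X Y : bimod A A) (e : X -> Y) (e_hom : bimod_hom e) :
    {linear ract_mod (tens (bimodBA phi) X) -> ract_mod (tens (bimodBA phi) Y)} :=
  @mk_linear A^c (ract_mod (tens (bimodBA phi) X)) (ract_mod (tens (bimodBA phi) Y))
    (tmap id e) (tens_mapD e_hom) (fun a t => tens_map_ract e_hom t a).
exact: (right_exact (f := rin _ _ _ f_hom) (g := rin _ _ _ g_hom) ex1).
Qed.
End Exactness.

Definition left_bc_unit (E : lmodType (env A)) (x : E) :
  env_mod (bichange (bimod_of_left E)) := bichange_unit (x : bimod_of_left E).

Lemma left_bc_unitD (E : lmodType (env A)) : {morph @left_bc_unit E : x y / x + y}.
Proof. exact: (bichange_unitD (M := bimod_of_left E)). Qed.

Lemma left_bc_unitZ (E : lmodType (env A)) r (x : E) :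
  left_bc_unit (r *: x) = env_map phi r *: left_bc_unit x.
Proof.
move: r; apply: env_additive_ext => [r s|r s|a b].
- by rewrite scalerDl; exact: bichange_unitD.
- by rewrite env_mapD scalerDl.
rewrite -bimod_of_leftE env_map_pure [RHS]env_scale_pure.
by rewrite -bichange_unit_ract -bichange_unit_lact.
Qed.

Lemma left_bc_span (E : lmodType (env A)) (y : env_mod (bichange (bimod_of_left E))) :
  exists s : seq (env B * E), y = \sum_(p <- s) p.1 *: left_bc_unit p.2.
Proof.
elim/bichange_ind: y => [|x y [s ->] [t ->]|b m b'].
- by exists [::]; rewrite big_nil.
- by exists (s ++ t); rewrite big_cat.
by exists [:: (epure b b', m)]; rewrite big_seq1 [RHS]env_scale_pure.
Qed.

Lemma left_bc_extend (E : lmodType (env A)) (N : lmodType (env B)) (v : E -> N) :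
  {morph v : x y / x + y} -> (forall r x, v (r *: x) = env_map phi r *: v x) ->
  exists w : {linear env_mod (bichange (bimod_of_left E)) -> N},
    forall x, w (left_bc_unit x) = v x.
Proof.
move=> vD vZ.
have vl (a : A) (x : bimod_of_left E) :
    v (lact a x) = lact (phi a) (v x : bimod_of_left N).
  by rewrite /= vZ env_map_pure rmorph1.
have vr (x : bimod_of_left E) (a : A) :
    v (ract x a) = ract (v x : bimod_of_left N) (phi a).
  by rewrite /= vZ env_map_pure rmorph1.
have [w [w_hom wE]] := bichange_extend (M := bimod_of_left E) (N := bimod_of_left N) vD vl vr.
have wZ (r : env B) x : w (r *: (x : env_mod (bichange (bimod_of_left E)))) = r *: (w x : N).
  move: r; apply: env_additive_ext => [r s|r s|a b].
  - by rewrite scalerDl; exact: hom_D.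
  - exact: scalerDl.
  by rewrite [_ *: x]env_scale_pure (hom_lact w_hom) (hom_ract w_hom) bimod_of_leftE.
by exists (@mk_linear _ (env_mod (bichange (bimod_of_left E))) N w (hom_D w_hom) wZ).
Qed.

(** Two-sided base change is A^e-base change to B^e, on left modules. *)
Definition left_bc : base_change (env_map phi) :=
  BaseChange left_bc_unitD left_bc_unitZ left_bc_span left_bc_extend.

Definition right_bc_unit (E : lmodType (env A)^c) (x : E) :
  renv_mod (bichange (bimod_of_right E)) := bichange_unit (x : bimod_of_right E).

Lemma right_bc_unitD (E : lmodType (env A)^c) : {morph @right_bc_unit E : x y / x + y}.
Proof. exact: (bichange_unitD (M := bimod_of_right E)). Qed.

Lemma right_bc_unitZ (E : lmodType (env A)^c) (r : (env A)^c) (x : E) :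
  right_bc_unit (r *: x) = (env_map phi r : (env B)^c) *: right_bc_unit x.
Proof.
move: r; apply: env_additive_ext => [r s|r s|a b].
- rewrite [_ *: x](scalerDl x (r : (env A)^c) s); exact: bichange_unitD.
- by rewrite env_mapD; exact: (scalerDl _ (env_map phi r : (env B)^c)).
rewrite -bimod_of_rightE env_map_pure [RHS]renv_scale_pure.
by rewrite -bichange_unit_ract -bichange_unit_lact.
Qed.

Lemma right_bc_span (E : lmodType (env A)^c)
    (y : renv_mod (bichange (bimod_of_right E))) :
  exists s : seq ((env B)^c * E), y = \sum_(p <- s) p.1 *: right_bc_unit p.2.
Proof.
elim/bichange_ind: y => [|x y [s ->] [t ->]|b m b'].
- by exists [::]; rewrite big_nil.
- by exists (s ++ t); rewrite big_cat.
by exists [:: (epure b' b : (env B)^c, m)]; rewrite big_seq1 [RHS]renv_scale_pure.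
Qed.

Lemma right_bc_extend (E : lmodType (env A)^c) (N : lmodType (env B)^c) (v : E -> N) :
  {morph v : x y / x + y} ->
  (forall (r : (env A)^c) x, v (r *: x) = (env_map phi r : (env B)^c) *: v x) ->
  exists w : {linear renv_mod (bichange (bimod_of_right E)) -> N},
    forall x, w (right_bc_unit x) = v x.
Proof.
move=> vD vZ.
have vl (a : A) (x : bimod_of_right E) :
    v (lact a x) = lact (phi a) (v x : bimod_of_right N).
  by rewrite /= vZ env_map_pure rmorph1.
have vr (x : bimod_of_right E) (a : A) :
    v (ract x a) = ract (v x : bimod_of_right N) (phi a).
  by rewrite /= vZ env_map_pure rmorph1.
have [w [w_hom wE]] := bichange_extend (M := bimod_of_right E) (N := bimod_of_right N) vD vl vr.
have wZ (r : (env B)^c) x : w (r *: (x : renv_mod (bichange (bimod_of_right E)))) = r *: (w x : N).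
  move: r; apply: env_additive_ext => [r s|r s|a b].
  - rewrite [_ *: x](scalerDl x (r : (env B)^c) s); exact: hom_D.
  - exact: (scalerDl _ (r : (env B)^c)).
  by rewrite [_ *: x]renv_scale_pure (hom_lact w_hom) (hom_ract w_hom) bimod_of_rightE.
by exists (@mk_linear _ (renv_mod (bichange (bimod_of_right E))) N w (hom_D w_hom) wZ).
Qed.

(** The same functor is base change on right modules: applied to the dual of a
    resolution of [A], it computes the dual of the base-changed resolution. *)
Definition right_bc : base_change (env_map phi : (env A)^c -> (env B)^c) :=
  BaseChange right_bc_unitD right_bc_unitZ right_bc_span right_bc_extend.

Section BaseChangeExact.
Hypotheses (left_exact : left_tensor_exact phi).
Hypotheses (right_exact : right_tensor_exact phi).

Lemma left_bc_exact : bc_exact left_bc.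
Proof.
move=> L M N f g ex.
have hom (X Y : lmodType (env A)) (e : {linear X -> Y}) :
    bimod_hom (e : bimod_of_left X -> bimod_of_left Y).
  by split=> [||]; [exact: raddfD | move=> a x; exact: linearZZ
                   | move=> x a; exact: linearZZ].
have mapE (X Y : lmodType (env A)) (e : {linear X -> Y}) :
    bc_map left_bc e =
      bichange_map (e : bimod_of_left X -> bimod_of_left Y) :> (_ -> _).
  apply/funext; elim/bichange_ind => [|x y IHx IHy|b x b'].
  - by rewrite [LHS]raddf0 (additive0 (bichange_mapD (hom _ _ e))).
  - apply: etrans (raddfD (bc_map left_bc e) x y) _.
    by rewrite (bichange_mapD (hom _ _ e)) -IHx -IHy.
  rewrite (bichange_map_unit (hom _ _ e)).
  transitivity (bc_map left_bc e (epure b b' *: left_bc_unit x)).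
    by congr (bc_map _ _ _); rewrite [RHS]env_scale_pure.
  rewrite linearZ /= bc_map_unit; exact: env_scale_pure.
have [h1 h2 h3] := bichange_exact left_exact right_exact (hom _ _ f) (hom _ _ g) ex.
by split; rewrite /= !mapE.
Qed.

Lemma right_bc_exact : bc_exact right_bc.
Proof.
move=> L M N f g ex.
have hom (X Y : lmodType (env A)^c) (e : {linear X -> Y}) :
    bimod_hom (e : bimod_of_right X -> bimod_of_right Y).
  by split=> [||]; [exact: raddfD | move=> a x; exact: linearZZ
                   | move=> x a; exact: linearZZ].
have mapE (X Y : lmodType (env A)^c) (e : {linear X -> Y}) :
    bc_map right_bc e =
      bichange_map (e : bimod_of_right X -> bimod_of_right Y) :> (_ -> _).
  apply/funext; elim/bichange_ind => [|x y IHx IHy|b x b'].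
  - by rewrite [LHS]raddf0 (additive0 (bichange_mapD (hom _ _ e))).
  - apply: etrans (raddfD (bc_map right_bc e) x y) _.
    by rewrite (bichange_mapD (hom _ _ e)) -IHx -IHy.
  rewrite (bichange_map_unit (hom _ _ e)).
  transitivity (bc_map right_bc e ((epure b' b : (env B)^c) *: right_bc_unit x)).
    by congr (bc_map _ _ _); rewrite [RHS]renv_scale_pure.
  rewrite linearZ /= bc_map_unit; exact: renv_scale_pure.
have [h1 h2 h3] := bichange_exact left_exact right_exact (hom _ _ f) (hom _ _ g) ex.
by split; rewrite /= !mapE.
Qed.

End BaseChangeExact.
End TwoSidedBaseChange.
(** * Isomorphisms between tensor products of bimodules *)

Section Isomorphic.
Variables (k : fieldType) (A C : algebra k).
Implicit Types M N L : bimod A C.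

Lemma bimod_hom_isomorphic M N (f : M -> N) (g : N -> M) :
  bimod_hom f -> cancel f g -> cancel g f -> isomorphic M N.
Proof. by case=> fD fl fr fK gK; constructor; exact: (BimodIso fD fl fr fK gK). Qed.

Lemma bimod_iso_hom M N (i : bimod_iso M N) : bimod_hom i.
Proof. by split; case: i. Qed.

Lemma bimod_iso_inv_hom M N (i : bimod_iso M N) : bimod_hom (iso_inv i).
Proof.
have i_inj : injective i := can_inj (iso_funK i).
split=> [x y|a x|x c]; apply: i_inj.
- by rewrite iso_D !iso_invK.
- by rewrite iso_lact !iso_invK.
- by rewrite iso_ract !iso_invK.
Qed.

Lemma isomorphic_refl M : isomorphic M M.
Proof. by apply: (@bimod_hom_isomorphic M M id id). Qed.

Lemma isomorphic_sym M N : isomorphic M N -> isomorphic N M.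
Proof.
by case=> i; exact: (bimod_hom_isomorphic (bimod_iso_inv_hom i) (iso_invK i) (iso_funK i)).
Qed.

Lemma isomorphic_trans M N L : isomorphic M N -> isomorphic N L -> isomorphic M L.
Proof.
case=> i [j]; apply: (@bimod_hom_isomorphic _ _ (j \o i) (iso_inv i \o iso_inv j)).
- split=> [x y|a x|x c] /=; first by rewrite !iso_D.
    by rewrite !iso_lact.
  by rewrite !iso_ract.
- by apply: can_comp; exact: iso_funK.
- by apply: can_comp; exact: iso_invK.
Qed.
End Isomorphic.

Section TensorIso.
Variable k : fieldType.
Implicit Types A B C D : algebra k.

Lemma tmap_hom A B C (M M' : bimod A B) (N N' : bimod B C)
    (f : M -> M') (g : N -> N') : bimod_hom f -> bimod_hom g ->
  bimod_hom (tmap f g : tens M N -> tens M' N') /\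
  forall m n, (tmap f g : tens M N -> tens M' N') (pure m n) = pure (f m) (g n).
Proof.
move=> [fD fl fr] [gD gl gr].
set h : tens M N -> tens M' N' := tmap f g.
have hp m n : h (pure m n) = pure (f m) (g n) by exact: tmap_pure.
have hD : {morph h : x y / x + y} by exact: tmapD.
split=> //; split=> // [a t|t c].
  elim/tensor_ind: t => [|x y IHx IHy|m n].
  - by rewrite lact0 (additive0 hD) lact0.
  - by rewrite lactDr !hD lactDr IHx IHy.
  - by rewrite lact_pure !hp lact_pure fl.
elim/tensor_ind: t => [|x y IHx IHy|m n].
- by rewrite ract0 (additive0 hD) ract0.
- by rewrite ractDl !hD ractDl IHx IHy.
- by rewrite ract_pure !hp ract_pure gr.
Qed.

Lemma tens_hom_ext A B C (M : bimod A B) (N : bimod B C) (V : zmodType)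
    (f g : tens M N -> V) : {morph f : x y / x + y} -> {morph g : x y / x + y} ->
  (forall m n, f (pure m n) = g (pure m n)) -> f =1 g.
Proof.
move=> fD gD fg; elim/tensor_ind => [|x y IHx IHy|m n] //.
  by rewrite (additive0 fD) (additive0 gD).
by rewrite fD gD IHx IHy.
Qed.

Lemma tens_iso A B C (M M' : bimod A B) (N N' : bimod B C) :
  isomorphic M M' -> isomorphic N N' -> isomorphic (tens M N) (tens M' N').
Proof.
case=> i [j].
have [f_hom fp] := tmap_hom (bimod_iso_hom i) (bimod_iso_hom j).
have [g_hom gp] := tmap_hom (bimod_iso_inv_hom i) (bimod_iso_inv_hom j).
set f : tens M N -> tens M' N' := tmap i j in f_hom fp.
set g : tens M' N' -> tens M N := tmap (iso_inv i) (iso_inv j) in g_hom gp.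
apply: (@bimod_hom_isomorphic _ _ _ _ _ f g) => //.
  elim/tensor_ind => [|x y IHx IHy|m n].
  - by rewrite (additive0 (hom_D f_hom)) (additive0 (hom_D g_hom)).
  - by rewrite (hom_D f_hom) (hom_D g_hom) IHx IHy.
  - by rewrite fp gp !iso_funK.
elim/tensor_ind => [|x y IHx IHy|m n].
- by rewrite (additive0 (hom_D g_hom)) (additive0 (hom_D f_hom)).
- by rewrite (hom_D g_hom) (hom_D f_hom) IHx IHy.
- by rewrite gp fp !iso_invK.
Qed.

Lemma tlift_hom A B C (M : bimod A B) (N : bimod B C) (V : zmodType)
    (f : M -> N -> V) :
  (forall m m' n, f (m + m') n = f m n + f m' n) ->
  (forall m n n', f m (n + n') = f m n + f m n') ->
  (forall m b n, f (ract m b) n = f m (lact b n)) ->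
  exists h : tens M N -> V,
    {morph h : x y / x + y} /\ forall m n, h (pure m n) = f m n.
Proof.
move=> f1 f2 f3; exists (tlift f).
by split; [exact: tliftD | exact: tlift_pure].
Qed.

Lemma tens_assoc A B C D (M : bimod A B) (N : bimod B C) (L : bimod C D) :
  isomorphic (tens (tens M N) L) (tens M (tens N L)).
Proof.
have /choice[f1 f1P] l : exists h : tens M N -> tens M (tens N L),
    {morph h : x y / x + y} /\ forall m n, h (pure m n) = pure m (pure n l).
  apply: (tlift_hom (f := fun m n => pure m (pure n l : tens N L) : tens M (tens N L))).
  - by move=> *; rewrite pureDl.
  - by move=> *; rewrite pureDl pureDr.
  - by move=> *; rewrite pure_bal lact_pure.
have [f [fD fp]] : exists h : tens (tens M N) L -> tens M (tens N L),
    {morph h : x y / x + y} /\ forall t l, h (pure t l) = f1 l t.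
  apply: (tlift_hom (f := fun t l => f1 l t)).
  - by move=> t t' l; case: (f1P l) => -> _.
  - move=> t l l'; move: t; apply: tens_hom_ext => [x y|x y|m n].
    + by case: (f1P (l + l')) => -> _.
    + by case: (f1P l) (f1P l') => -> _ [-> _]; rewrite addrACA.
    + by case: (f1P l) (f1P l') (f1P (l + l')) => _ -> [_ ->] [_ ->];
        rewrite pureDr pureDr.
  - move=> t c l; move: t; apply: tens_hom_ext => [x y|x y|m n].
    + by rewrite ractDl; case: (f1P l) => -> _.
    + by case: (f1P (lact c l)) => -> _.
    + rewrite ract_pure; case: (f1P l) (f1P (lact c l)) => _ -> [_ ->].
      by rewrite pure_bal.
have /choice[g1 g1P] m : exists h : tens N L -> tens (tens M N) L,
    {morph h : x y / x + y} /\ forall n l, h (pure n l) = pure (pure m n) l.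
  apply: (tlift_hom (f := fun n l => pure (pure m n : tens M N) l : tens (tens M N) L)).
  - by move=> *; rewrite pureDr pureDl.
  - by move=> *; rewrite pureDr.
  - by move=> *; rewrite -pure_bal ract_pure.
have [g [gD gp]] : exists h : tens M (tens N L) -> tens (tens M N) L,
    {morph h : x y / x + y} /\ forall m t, h (pure m t) = g1 m t.
  apply: (tlift_hom (f := fun m t => g1 m t)).
  - move=> m m' t; move: t; apply: tens_hom_ext => [x y|x y|n l].
    + by case: (g1P (m + m')) => -> _.
    + by case: (g1P m) (g1P m') => -> _ [-> _]; rewrite addrACA.
    + by case: (g1P m) (g1P m') (g1P (m + m')) => _ -> [_ ->] [_ ->];
        rewrite pureDl pureDl.
  - by move=> m t t'; case: (g1P m) => -> _.
  - move=> m b t; move: t; apply: tens_hom_ext => [x y|x y|n l].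
    + by case: (g1P (ract m b)) => -> _.
    + by rewrite lactDr; case: (g1P m) => -> _.
    + rewrite lact_pure; case: (g1P m) (g1P (ract m b)) => _ -> [_ ->].
      by rewrite pure_bal.
have fpp m n l : f (pure (pure m n) l) = pure m (pure n l).
  by rewrite fp; case: (f1P l).
have gpp m n l : g (pure m (pure n l)) = pure (pure m n) l.
  by rewrite gp; case: (g1P m).
have ext3 (V : zmodType) (u v : tens (tens M N) L -> V) :
    {morph u : x y / x + y} -> {morph v : x y / x + y} ->
    (forall m n l, u (pure (pure m n) l) = v (pure (pure m n) l)) -> u =1 v.
  move=> uD vD uv; apply: tens_hom_ext => // t l; move: t.
  apply: (tens_hom_ext (f := fun t => u (pure t l)) (g := fun t => v (pure t l))) => //.
    by move=> x y; rewrite pureDl uD.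
  by move=> x y; rewrite pureDl vD.
have ext3' (V : zmodType) (u v : tens M (tens N L) -> V) :
    {morph u : x y / x + y} -> {morph v : x y / x + y} ->
    (forall m n l, u (pure m (pure n l)) = v (pure m (pure n l))) -> u =1 v.
  move=> uD vD uv; apply: tens_hom_ext => // m t; move: t.
  apply: (tens_hom_ext (f := fun t => u (pure m t)) (g := fun t => v (pure m t))) => //.
    by move=> x y; rewrite pureDr uD.
  by move=> x y; rewrite pureDr vD.
apply: (@bimod_hom_isomorphic _ _ _ _ _ f g).
- split=> // [a t|t c].
    apply: (ext3 _ (fun t => f (lact a t)) (fun t => lact a (f t))) t.
    + by move=> x y; rewrite lactDr fD.
    + by move=> x y; rewrite fD lactDr.
    + by move=> m n l; rewrite !lact_pure !fpp lact_pure.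
  apply: (ext3 _ (fun t => f (ract t c)) (fun t => ract (f t) c)) t.
  + by move=> x y; rewrite ractDl fD.
  + by move=> x y; rewrite fD ractDl.
  + by move=> m n l; rewrite !ract_pure !fpp !ract_pure.
- apply: (ext3 _ (fun t => g (f t)) id) => // [x y|m n l]; last by rewrite fpp gpp.
  by rewrite fD gD.
- apply: (ext3' _ (fun t => f (g t)) id) => // [x y|m n l]; last by rewrite gpp fpp.
  by rewrite gD fD.
Qed.

Lemma tens_unitl A C (N : bimod A C) : isomorphic (tens (reg_bimod A) N) N.
Proof.
have [f [fD fp]] : exists h : tens (reg_bimod A) N -> N,
    {morph h : x y / x + y} /\ forall (a : A) n, h (pure a n) = lact a n.
  apply: (@tlift_hom _ _ _ (reg_bimod A) N _ (fun (a : A) n => lact a n)).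
  - by move=> *; exact: lactDl.
  - by move=> *; exact: lactDr.
  - by move=> *; exact: lactM.
apply: (@bimod_hom_isomorphic _ _ _ _ _ f (fun n => pure (1 : A) n)).
- split=> // [a t|t c].
    move: t; apply: tens_hom_ext => [x y|x y|a' n].
    + by rewrite lactDr fD.
    + by rewrite fD lactDr.
    + by rewrite lact_pure !fp -lactM.
  move: t; apply: tens_hom_ext => [x y|x y|a' n].
  + by rewrite ractDl fD.
  + by rewrite fD ractDl.
  + by rewrite ract_pure !fp lractA.
- apply: tens_hom_ext => [x y|//|a n]; first by rewrite fD pureDr.
  by rewrite fp -pure_bal /= mul1r.
- by move=> n; rewrite fp lact1.
Qed.

Lemma tens_unitr A C (N : bimod C A) : isomorphic (tens N (reg_bimod A)) N.
Proof.
have [f [fD fp]] : exists h : tens N (reg_bimod A) -> N,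
    {morph h : x y / x + y} /\ forall n (a : A), h (pure n a) = ract n a.
  apply: (@tlift_hom _ _ _ N (reg_bimod A) _ (fun n (a : A) => ract n a)).
  - by move=> *; exact: ractDl.
  - by move=> *; exact: ractDr.
  - by move=> *; rewrite /= ractM.
apply: (@bimod_hom_isomorphic _ _ _ _ _ f (fun n => pure n (1 : A))).
- split=> // [a t|t c].
    move: t; apply: tens_hom_ext => [x y|x y|a' n].
    + by rewrite lactDr fD.
    + by rewrite fD lactDr.
    + by rewrite lact_pure !fp lractA.
  move: t; apply: tens_hom_ext => [x y|x y|a' n].
  + by rewrite ractDl fD.
  + by rewrite fD ractDl.
  + by rewrite ract_pure !fp -ractM.
- apply: tens_hom_ext => [x y|//|n a]; first by rewrite fD pureDl.
  by rewrite fp pure_bal /= mulr1.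
- by move=> n; rewrite fp ract1.
Qed.

Lemma res_iso A' A B' B (f : alg_hom A' A) (g : alg_hom B' B) (M N : bimod A B) :
  isomorphic M N -> isomorphic (res_bimod f g M) (res_bimod f g N).
Proof.
case=> i; apply: (@bimod_hom_isomorphic _ _ _ (res_bimod f g M) (res_bimod f g N)
  i (iso_inv i)); [|exact: (iso_funK i)|exact: (iso_invK i)].
by split=> [x y|a x|x b] /=; rewrite ?(iso_D i, iso_lact i, iso_ract i).
Qed.

(** Both sides have the same carrier and actions, but carry different proofs of
    the bimodule axioms, so they are identified by an isomorphism. *)
Lemma res_tensl A' A B C (f : alg_hom A' A) (M : bimod A B) (N : bimod B C) :
  isomorphic (res_bimod f (alg_id C) (tens M N))
             (tens (res_bimod f (alg_id B) M) N).
Proof.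
exact: (@bimod_hom_isomorphic _ _ _ (res_bimod f (alg_id C) (tens M N))
  (tens (res_bimod f (alg_id B) M) N) id id).
Qed.

Lemma res_tensr A B C' C (f : alg_hom C' C) (M : bimod A B) (N : bimod B C) :
  isomorphic (res_bimod (alg_id A) f (tens M N))
             (tens M (res_bimod (alg_id B) f N)).
Proof.
exact: (@bimod_hom_isomorphic _ _ _ (res_bimod (alg_id A) f (tens M N))
  (tens M (res_bimod (alg_id B) f N)) id id).
Qed.

End TensorIso.

Section EnvIso.
Variables (k : fieldType) (A : algebra k).

Lemma env_mod_iso (M N : bimod A A) :
  isomorphic M N -> lmod_iso (env_mod M) (env_mod N).
Proof.
case=> i.
have iZ (r : env A) (x : env_mod M) : i (r *: x) = r *: (i x : env_mod N).
  move: r; apply: env_additive_ext => [r s|r s|a b].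
  - by rewrite scalerDl; exact: (iso_D i).
  - exact: (@scalerDl _ (env_mod N) (i x)).
  rewrite [_ *: x]env_scale_pure (iso_lact i) (iso_ract i).
  exact/esym/env_scale_pure.
exists (@mk_linear _ (env_mod M) (env_mod N) i (iso_D i) iZ), (iso_inv i).
  exact: iso_funK.
exact: iso_invK.
Qed.

Lemma bimod_of_left_env_mod (M : bimod A A) : isomorphic (bimod_of_left (env_mod M)) M.
Proof.
apply: (@bimod_hom_isomorphic _ _ _ (bimod_of_left (env_mod M)) M id id) => //.
split=> // [a x|x b].
  by rewrite /= [LHS]env_scale_pure ract1.
by rewrite /= [LHS]env_scale_pure lact1.
Qed.

Lemma bimod_of_right_renv_mod (M : bimod A A) :
  isomorphic (bimod_of_right (renv_mod M)) M.
Proof.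
apply: (@bimod_hom_isomorphic _ _ _ (bimod_of_right (renv_mod M)) M id id) => //.
split=> // [a x|x b].
  by rewrite /= [LHS]renv_scale_pure ract1.
by rewrite /= [LHS]renv_scale_pure lact1.
Qed.

Lemma bimod_of_right_iso (E E' : lmodType (env A)^c) :
  lmod_iso E E' -> isomorphic (bimod_of_right E) (bimod_of_right E').
Proof.
case=> f [g fK gK].
apply: (@bimod_hom_isomorphic _ _ _ (bimod_of_right E) (bimod_of_right E') f g) => //.
by split=> [||]; [exact: raddfD | move=> a x; exact: linearZZ
                   | move=> x a; exact: linearZZ].
Qed.

Lemma VdB_iso d (U U' : bimod A A) : isomorphic U U' -> VdB d U -> VdB d U'.
Proof.
move=> UU' [fg pd vanish dual [Q [UQ QU]]]; split=> //.
  exact: isomorphic_trans UU'.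
have U'U := isomorphic_sym UU'.
exists Q; split.
  exact: isomorphic_trans (tens_iso U'U (isomorphic_refl Q)) UQ.
exact: isomorphic_trans (tens_iso (isomorphic_refl Q) U'U) QU.
Qed.
End EnvIso.
(** * Van den Bergh duality along a flat epimorphism *)

Section Epimorphism.
Variables (k : fieldType) (A B : algebra k) (phi : alg_hom A B).
Hypothesis mult_iso : bijective (@mult_map k A B phi).

Local Notation BA := (bimodBA phi).
Local Notation AB := (bimodAB phi).
Local Notation AA := (bimodAA phi).

Lemma tens_BA_AB : isomorphic (tens BA AB) (reg_bimod B).
Proof.
have [h [hD hp]] : exists h : tens BA AB -> B, {morph h : x y / x + y} /\
    forall b b' : B, h (pure (b : BA) (b' : AB)) = b * b'.
  apply: (@tlift_hom _ _ _ _ BA AB B (fun b b' : B => b * b')).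
  - by move=> *; exact: mulrDl.
  - by move=> *; exact: mulrDr.
  - by move=> b a b'; rewrite /= mulrA.
have mD : {morph @mult_map k A B phi : x y / x + y}.
  apply: tliftD => [m m' n|m n n'|b a b'].
  - exact: mulrDl.
  - exact: mulrDr.
  - by rewrite /= mulrA.
have hE : h =1 @mult_map k A B phi.
  apply: tens_hom_ext => // b b'; rewrite hp /mult_map tlift_pure // => *.
  - exact: mulrDl.
  - exact: mulrDr.
  - by rewrite /= mulrA.
have [m mK Km] := mult_iso.
apply: (@bimod_hom_isomorphic _ _ _ (tens BA AB) (reg_bimod B) h m).
- split=> // [b t|t b].
    move: t; apply: tens_hom_ext => [x y|x y|c c'].
    + by rewrite lactDr hD.
    + by rewrite hD lactDr.
    + by rewrite lact_pure !hp /= mulrA.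
  move: t; apply: tens_hom_ext => [x y|x y|c c'].
  + by rewrite ractDl hD.
  + by rewrite hD ractDl.
  + by rewrite ract_pure !hp /= mulrA.
- by move=> x; rewrite hE mK.
- by move=> x; rewrite hE Km.
Qed.

Lemma res_AB : isomorphic (res_bimod (alg_id A) phi AB) AA.
Proof. by apply: (@bimod_hom_isomorphic _ _ _ (res_bimod (alg_id A) phi AB) AA id id). Qed.

Lemma res_BA : isomorphic (res_bimod phi (alg_id A) BA) AA.
Proof. by apply: (@bimod_hom_isomorphic _ _ _ (res_bimod phi (alg_id A) BA) AA id id). Qed.

Lemma tens_BA_AA : isomorphic (tens BA AA) BA.
Proof.
apply: isomorphic_trans (res_iso (alg_id B) phi tens_BA_AB).
apply: isomorphic_trans (isomorphic_sym (res_tensr phi BA AB)).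
exact: tens_iso (isomorphic_refl BA) (isomorphic_sym res_AB).
Qed.

Lemma tens_AA_AB : isomorphic (tens AA AB) AB.
Proof.
apply: isomorphic_trans (res_iso phi (alg_id B) tens_BA_AB).
apply: isomorphic_trans (isomorphic_sym (res_tensl phi BA AB)).
exact: tens_iso (isomorphic_sym res_BA) (isomorphic_refl AB).
Qed.

Lemma bichange_reg : isomorphic (bichange phi (reg_bimod A)) (reg_bimod B).
Proof.
apply: isomorphic_trans tens_BA_AB; apply: tens_iso; last exact: isomorphic_refl.
exact: tens_unitr.
Qed.

Lemma bichange_iso (M N : bimod A A) :
  isomorphic M N -> isomorphic (bichange phi M) (bichange phi N).
Proof.
move=> MN; apply: tens_iso; last exact: isomorphic_refl.
by apply: tens_iso; first exact: isomorphic_refl.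
Qed.

(** The middle factor B (x)_B B of (B M B) (x)_B (B N B) collapses to [B]. *)
Lemma bichange_tens (M N : bimod A A) :
  isomorphic (tens (bichange phi M) (bichange phi N))
             (tens BA (tens M (tens (tens AA N) AB))).
Proof.
apply: isomorphic_trans (tens_assoc _ _ _) _.
apply: isomorphic_trans (tens_assoc _ _ _).
apply: tens_iso; first exact: isomorphic_refl.
apply: isomorphic_trans (isomorphic_sym (res_tensl phi (reg_bimod B) (bichange phi N))) _.
apply: isomorphic_trans (res_iso phi (alg_id B) (tens_unitl _)) _.
apply: isomorphic_trans (res_tensl phi (tens BA N) AB) _.
apply: tens_iso (isomorphic_refl _).
apply: isomorphic_trans (res_tensl phi BA N) _.
exact: tens_iso res_BA (isomorphic_refl N).
Qed.

Variable U : bimod A A.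
Hypothesis U_commutes : isomorphic (tens AA U) (tens U AA).

(** B (U B) = B (B U) = (B B) U = B U. *)
Lemma bichange_restrict :
  isomorphic (res_bimod (alg_id B) phi (bichange phi U)) (tens BA U).
Proof.
apply: isomorphic_trans (res_tensr phi (tens BA U) AB) _.
apply: isomorphic_trans (tens_assoc _ _ _) _.
apply: isomorphic_trans (tens_iso (isomorphic_refl BA) _) _.
  apply: isomorphic_trans (tens_iso (isomorphic_refl U) res_AB) _.
  exact: isomorphic_sym U_commutes.
apply: isomorphic_trans (isomorphic_sym (tens_assoc _ _ _)) _.
exact: tens_iso tens_BA_AA (isomorphic_refl U).
Qed.

(** If [Q] is inverse to [U], then B Q B is inverse to B U B: moving [U] across
    the middle factor [B], one gets B (U B) Q B = B B (U Q) B = B, and likewise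
    B Q (B U) B = B (Q U) B B = B. *)
Lemma bichange_invertible : invertible U -> invertible (bichange phi U).
Proof.
case=> Q [UQ QU]; have reflB := isomorphic_refl AB.
have BB : isomorphic (tens BA (tens (reg_bimod A) AB)) (reg_bimod B).
  apply: isomorphic_trans tens_BA_AB.
  exact: tens_iso (isomorphic_refl BA) (tens_unitl AB).
exists (bichange phi Q); split.
  apply: isomorphic_trans (bichange_tens U Q) _.
  apply: isomorphic_trans BB; apply: tens_iso; first exact: isomorphic_refl.
  apply: (@isomorphic_trans _ _ _ _ (tens (tens (tens AA U) Q) AB)).
    apply: isomorphic_trans (isomorphic_sym (tens_assoc _ _ _)) _.
    apply: tens_iso reflB.
    apply: isomorphic_trans (isomorphic_sym (tens_assoc _ _ _)) _.
    exact: tens_iso (isomorphic_sym U_commutes) (isomorphic_refl Q).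
  apply: (@isomorphic_trans _ _ _ _ (tens AA AB)).
    apply: tens_iso reflB.
    apply: isomorphic_trans (tens_assoc _ _ _) _.
    apply: isomorphic_trans (tens_iso (isomorphic_refl AA) UQ) (tens_unitr AA).
  apply: isomorphic_trans tens_AA_AB _; exact: isomorphic_sym (tens_unitl AB).
apply: isomorphic_trans (bichange_tens Q U) _.
apply: isomorphic_trans BB; apply: tens_iso; first exact: isomorphic_refl.
apply: (@isomorphic_trans _ _ _ _ (tens Q (tens U AB))).
  apply: tens_iso; first exact: isomorphic_refl.
  apply: isomorphic_trans (tens_iso U_commutes reflB) _.
  apply: isomorphic_trans (tens_assoc _ _ _) _.
  exact: tens_iso (isomorphic_refl U) tens_AA_AB.
apply: isomorphic_trans (isomorphic_sym (tens_assoc _ _ _)) _.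
exact: tens_iso QU reflB.
Qed.

End Epimorphism.

Section Main.
Variables (k : fieldType) (A B : algebra k) (phi : alg_hom A B).
Hypothesis left_exact : left_tensor_exact phi.
Hypothesis right_exact : right_tensor_exact phi.
Hypothesis mult_iso : bijective (@mult_map k A B phi).

Lemma left_bc_reg :
  lmod_iso (left_bc phi (env_mod (reg_bimod A))) (env_mod (reg_bimod B)).
Proof.
apply: env_mod_iso; apply: isomorphic_trans (bichange_reg mult_iso).
exact: bichange_iso (bimod_of_left_env_mod _).
Qed.

(** As B (x)_A A (x)_A B = B, the bimodule [B] is the base change of [A], and
    base change commutes with Ext. *)
Lemma Ext_env_bichange n : fg_proj_resolvable (env_mod (reg_bimod A)) ->
  isomorphic (Ext_env B n) (bichange phi (Ext_env A n)).
Proof.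
move=> A_fg.
apply: isomorphic_trans (bimod_of_right_renv_mod (bichange phi (Ext_env A n))).
apply: isomorphic_sym; apply: bimod_of_right_iso.
exact: (bc_Ext (left_bc_exact left_exact right_exact)
               (right_bc_exact left_exact right_exact) n left_bc_reg A_fg).
Qed.

Lemma bichange_eq0 (M : bimod A A) :
  (forall x : M, x = 0) -> forall y : bichange phi M, y = 0.
Proof.
move=> M0; elim/bichange_ind => [//|x y -> ->|b m b']; first by rewrite addr0.
by rewrite (M0 m) (additive0 (@bichange_unitD _ _ _ phi M)) ract0 lact0.
Qed.

Lemma isomorphic_eq0 (A' C' : algebra k) (M N : bimod A' C') :
  isomorphic M N -> (forall y : N, y = 0) -> forall x : M, x = 0.
Proof.
by case=> i N0 x; apply: (can_inj (iso_funK i)); rewrite [LHS]N0 [RHS]N0.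
Qed.

Lemma bichange_VdB d (U : bimod A A) :
  isomorphic (tens (bimodAA phi) U) (tens U (bimodAA phi)) ->
  VdB d U -> VdB d (bichange phi U).
Proof.
move=> U_commutes [A_fg A_pd A_vanish A_dual A_inv].
split.
- exact: (bc_fg_proj_resolvable (left_bc_exact left_exact right_exact) left_bc_reg).
- exact: (bc_fin_proj_dim (left_bc_exact left_exact right_exact) left_bc_reg).
- move=> n /A_vanish An0; apply: isomorphic_eq0 (Ext_env_bichange n A_fg) _.
  exact: bichange_eq0.
- case: d A_dual {A_vanish} => n A_dual /=.
    exact: isomorphic_trans (Ext_env_bichange n A_fg) (bichange_iso _ A_dual).
  (* In negative degree the dualizing bimodule vanishes. *)
  have U0 : forall x : U, x = 0.
    by apply: isomorphic_eq0 (isomorphic_sym A_dual) _ => x; exact: thinmx0.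
  have BUB0 := bichange_eq0 U0.
  apply: (@bimod_hom_isomorphic _ _ _ (zero_bimod B B) (bichange phi U)
    (fun _ => 0) (fun _ => 0)).
  + by split=> [x y|b x|x b]; rewrite ?addr0 ?lact0 ?ract0.
  + by move=> x; rewrite [RHS]thinmx0.
  + by move=> x; rewrite [RHS]BUB0.
- exact: bichange_invertible.
Qed.
End Main.

Theorem theorem1p5 (k : fieldType) (char0 : [pchar k] =i pred0) (d : int)
    (A : algebra k) (U : bimod A A) (A_VdB : VdB d U)
    (B : algebra k) (phi : alg_hom A B)
    (B_tensor_exact : left_tensor_exact phi)
    (tensor_B_exact : right_tensor_exact phi)
    (mult_iso : bijective (@mult_map k A B phi))
    (U_commutes : isomorphic (tens (bimodAA phi) U) (tens U (bimodAA phi))) :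
  let BU : bimod B A := tens (bimodBA phi) U in
  let BUB : bimod B B := tens BU (bimodAB phi) in
  [/\ VdB d BUB,
      isomorphic BU (res_bimod (alg_id B) phi BUB) &
      forall i : bimod_iso BU (res_bimod (alg_id B) phi BUB),
        VdB d (transport_bimod i)].
Proof.
move=> BU BUB.
have BUB_VdB : VdB d BUB by exact: bichange_VdB.
split=> // [|i]; first exact/isomorphic_sym/bichange_restrict.
(* [i] itself is B-bilinear for the transported structure. *)
apply: VdB_iso BUB_VdB; apply: isomorphic_sym.
apply: (@bimod_hom_isomorphic _ _ _ (transport_bimod i) BUB i (iso_inv i)).
- split=> [x y|b x|x b]; [exact: (iso_D i) | exact: (iso_lact i) | exact: transport_ractE].
- exact: (iso_funK i).
- exact: (iso_invK i).
Qed.
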